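(* Let $\mathfrak g_i$, $i=1,2$, be two simple Lie algebras with root lattices $\mathcal Q_i$, Dynkin diagrams $\Gamma_i$ and sets of simple roots $\Pi_i$ (considered as the set of vertices of $\Gamma_i$). Let $\mathbb K$ be an arbitrary base field, $q\in\mathbb{K}^*$ not a root of unity, and let $\mathbf p_i\in Z^2(\mathcal Q_i,\mathbb K^* )$, $i=1,2$, be 2-cocycles such that for $i=1,2$ $$q_\alpha\,\mathbf r_i(\alpha,\alpha')\ne1\quad\text{and}\quad q_\alpha^{-1}\,\mathbf r_i(\alpha,\alpha')\ne1\qquad\text{for all }\alpha,\alpha'\in\Pi_i\text{ with }a_{\alpha\alpha'}=-1,$$ and such that $G_{\mathbf p_1}G_{\mathbf p_2}$ is a torsion-free subgroup of $\mathbb K^*$. Then (for each choice of sign) $$\mathcal{U}^\pm_{q,\mathbf p_1}(\mathfrak g_1)\cong\mathcal{U}^\pm_{q,\mathbf p_2}(\mathfrak g_2)$$ as $\mathbb K$-algebras if and only if $\mathfrak g_1\cong\mathfrak g_2$ and there exists a graph isomorphism $\theta\colon\Gamma_1\to\Gamma_2$ such that $$\mathbf r_2(\theta(\alpha),\theta(\alpha'))=\mathbf r_1(\alpha,\alpha')\qquad\text{for all }\alpha,\alpha'\in\Pi_1.$$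
   Context: For a complex simple Lie algebra $\mathfrak g$ with simple roots $\Pi$ and root lattice $\mathcal Q=\mathbb Z\Pi$: $\langle\cdot,\cdot\rangle$ is the Weyl group invariant bilinear form on $\mathbb{R}\Pi$ with $\langle\alpha,\alpha\rangle=2$ for short simple roots; $a_{\alpha\alpha'}=2\langle\alpha,\alpha'\rangle/\langle\alpha,\alpha\rangle$; $q_\alpha=q^{\langle\alpha,\alpha\rangle/2}$. $\mathcal{U}_q^-(\mathfrak g)$ is the unital associative $\mathbb K$-algebra with generators $F_\alpha$ ($\alpha\in\Pi$) and relations $$\sum_{j=0}^{1-a_{\alpha\alpha'}}(-1)^j\begin{bmatrix}1-a_{\alpha\alpha'}\\ j\end{bmatrix}_{q_\alpha}F_\alpha^{\,j}F_{\alpha'}F_\alpha^{\,1-a_{\alpha\alpha'}-j}=0,\qquad \alpha\ne\alpha'\in\Pi,$$ where $\begin{bmatrix}m\\ j\end{bmatrix}_q=[m]_q!/([j]_q![m-j]_q!)$, $[m]_q!=[1]_q\cdots[m]_q$, $[m]_q=(q^m-q^{-m})/(q-q^{-1})$; $\mathcal{U}_q^+(\mathfrak g)$ is defined by the same relations with generators $E_\alpha$. They are $\mathcal Q$-graded with $E_\alpha,F_\alpha$ of degrees $\alpha,-\alpha$. $Z^2(\mathcal Q,\mathbb K^* )$ is the group of 2-cocycles of $\mathcal Q$ with values in $\mathbb K^*$ (trivial action). For $\mathbf p\in Z^2(\mathcal Q,\mathbb K^* )$, $\mathcal{U}_{q,\mathbf p}^\pm(\mathfrak g)$ is the vector space $\mathcal{U}_q^\pm(\mathfrak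 g)$ with the twisted product $u_1*u_2=\mathbf p(c_1,c_2)u_1u_2$ for $u_i$ homogeneous of degree $c_i\in\mathcal Q$. Put $\mathbf r(c_1,c_2)=\mathbf p(c_1,c_2)\mathbf p(c_2,c_1)^{-1}$ (and $\mathbf r_i$ for $\mathbf p_i$). $G_{\mathbf p}$ is the subgroup of $\mathbb K^*$ generated by $q^2$ and all $q^{-\langle\alpha,\alpha'\rangle}\mathbf r(\alpha,\alpha')$, $\alpha\ne\alpha'\in\Pi$. A graph isomorphism of Dynkin diagrams is an isomorphism of directed graphs, i.e. a bijection $\theta$ of simple roots with $a_{\theta(\alpha)\theta(\alpha')}=a_{\alpha\alpha'}$. *)

(* Defs.v *)
From HB Require Import structures.
From mathcomp Require Import all_boot all_order all_algebra finmap.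
From mathcomp Require Import ring boolp reals complex.
From mathcomp.multinomials Require Import monalg.

Set Implicit Arguments.
Unset Strict Implicit.
Unset Printing Implicit Defensive.

Import GRing.Theory.
Local Open Scope quotient_scope.
Local Open Scope ring_scope.

Record lieAlgebra (C : fieldType) := LieAlgebra {
  lie_space :> vectType C;
  bracket : lie_space -> lie_space -> lie_space;
  bracket_linearl : forall y, linear (bracket^~ y);
  bracket_linearr : forall x, linear (bracket x);
  bracket_alt : forall x, bracket x x = 0;
  bracket_jacobi : forall x y z,
    bracket x (bracket y z) + bracket y (bracket z x)
      + bracket z (bracket x y) = 0
}.

Definition lie_simple (C : fieldType) (g : lieAlgebra C) : Prop :=
  (exists x y : g, bracket x y <> 0) /\
  forall V : {vspace g}, (forall x y : g, y \in V -> bracket x y \in V) ->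
    V = 0%VS \/ V = fullv.

Definition lie_isomorphic (C : fieldType) (g1 g2 : lieAlgebra C) : Prop :=
  exists f : {linear g1 -> g2},
    bijective f /\ forall x y, f (bracket x y) = bracket (f x) (f y).

(* Z Pi, in coordinates with respect to the basis Pi. *)
Definition lattice (Pi : finType) : Type := {ffun Pi -> int}.
HB.instance Definition _ (Pi : finType) := GRing.Zmodule.on (lattice Pi).

Definition simple_root (Pi : finType) (i : Pi) : lattice Pi :=
  [ffun j => (j == i)%:Z].

Definition reflection (Pi : finType) (a : Pi -> Pi -> int) (i : Pi)
    (x : lattice Pi) : lattice Pi :=
  x - simple_root i *~ (\sum_j a i j * x j).

(* The Weyl group invariant inner product on R Pi for which short simple
   roots have square length 2.  It takes integral, on the diagonal even,
   values on the root lattice, which determine it. *)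
Record invariantForm (Pi : finType) (a : Pi -> Pi -> int) := InvariantForm {
  form :> lattice Pi -> lattice Pi -> int;
  formDl : forall x y z, form (x + y) z = form x z + form y z;
  formC : forall x y, form x y = form y x;
  form_gt0 : forall x, x != 0 -> (0 < form x x)%R;
  form_reflection : forall i x y,
    form (reflection a i x) (reflection a i y) = form x y;
  form_even : forall x, (2 %| form x x)%Z;
  form_ge2 : forall i, (2 <= form (simple_root i) (simple_root i))%R;
  form_short : exists i, form (simple_root i) (simple_root i) = 2
}.

(* A complex simple Lie algebra together with the choices made when one
   speaks of its simple roots Pi: the Cartan subalgebra (spanned by the
   coroots h_i = [e_i, f_i], i in Pi) and Chevalley generators e_i, f_i in
   the root spaces of the simple roots i and -i.  The simple root j takes the
   value a_ij = cartan i j at h_i; with <,> = iform, this is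
   2 <i, j> / <i, i>. *)
Record simpleLie (R : realType) := SimpleLie {
  lie :> lieAlgebra R[i];
  lie_simpleP : lie_simple lie;
  Pi : finType;
  cartan : Pi -> Pi -> int;
  chev_e : Pi -> lie;
  chev_f : Pi -> lie;
  cartan_diag : forall i, cartan i i = 2;
  chev_ef : forall i j, i != j -> bracket (chev_e i) (chev_f j) = 0;
  chev_hh : forall i j,
    bracket (bracket (chev_e i) (chev_f i))
            (bracket (chev_e j) (chev_f j)) = 0;
  chev_he : forall i j,
    bracket (bracket (chev_e i) (chev_f i)) (chev_e j)
      = (cartan i j)%:~R *: chev_e j;
  chev_hf : forall i j,
    bracket (bracket (chev_e i) (chev_f i)) (chev_f j)
      = - (cartan i j)%:~R *: chev_f j;
  chev_h_free : free [seq bracket (chev_e i) (chev_f i) | i <- enum Pi];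
  chev_generate : forall V : {vspace lie},
    (forall i, chev_e i \in V) -> (forall i, chev_f i \in V) ->
    (forall x y, x \in V -> y \in V -> bracket x y \in V) -> V = fullv;
  iform : invariantForm cartan
}.

Definition dynkin_iso (R : realType) (g1 g2 : simpleLie R)
    (theta : Pi g1 -> Pi g2) : Prop :=
  bijective theta /\
  forall i j, cartan (theta i) (theta j) = cartan i j.

Section QuantumInteger.
Variables (K : fieldType) (q : K).

Definition qint (m : nat) : K := (q ^+ m - q ^- m) / (q - q^-1).
Definition qfact (m : nat) : K := \prod_(1 <= k < m.+1) qint k.
Definition qbin (m j : nat) : K := qfact m / (qfact j * qfact (m - j)).

End QuantumInteger.

(* q_alpha = q^(<alpha, alpha> / 2) *)
Definition qroot (R : realType) (g : simpleLie R) (K : fieldType) (q : K)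
    (i : Pi g) : K :=
  q ^ ((iform g (simple_root i) (simple_root i)) %/ 2)%Z.

Record cocycle (Q : zmodType) (K : fieldType) := Cocycle {
  cocycle_val :> Q -> Q -> K;
  cocycle_neq0 : forall x y, cocycle_val x y != 0;
  cocycleP : forall x y z,
    cocycle_val x y * cocycle_val (x + y) z
      = cocycle_val y z * cocycle_val x (y + z)
}.

Definition cocycle_r (Q : zmodType) (K : fieldType) (p : cocycle Q K)
    (x y : Q) : K :=
  p x y / p y x.

Lemma cocycle0l (Q : zmodType) (K : fieldType) (p : cocycle Q K) x :
  p 0 x = p 0 0.
Proof.
have := cocycleP p 0 0 x; rewrite !add0r => /mulIf H.
by apply/esym/H/cocycle_neq0.
Qed.

Lemma cocycle0r (Q : zmodType) (K : fieldType) (p : cocycle Q K) x :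
  p x 0 = p 0 0.
Proof.
have := cocycleP p x 0 0; rewrite !addr0 [RHS]mulrC.
by move/(mulfI (cocycle_neq0 p x 0)).
Qed.

Record properIdeal (K : fieldType) (A : algType K) := ProperIdeal {
  in_ideal :> A -> Prop;
  ideal0 : in_ideal 0;
  idealD : forall x y, in_ideal x -> in_ideal y -> in_ideal (x + y);
  idealMl : forall x y, in_ideal y -> in_ideal (x * y);
  idealMr : forall x y, in_ideal x -> in_ideal (x * y);
  ideal1 : ~ in_ideal 1
}.

Section QuotientAlgebra.
Variables (K : fieldType) (A : algType K) (J : properIdeal A).

Lemma idealZ (c : K) x : J x -> J (c *: x).
Proof. by move=> Jx; rewrite -[x]mul1r scalerAl; apply: idealMl. Qed.

Lemma idealN x : J x -> J (- x).
Proof. by move=> Jx; rewrite -scaleN1r; apply: idealZ. Qed.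

Definition ideal_eq (x y : A) : bool := `[< J (x - y) >].

Lemma ideal_eq_equiv : equiv_class_of ideal_eq.
Proof.
split=> [x | x y | y x z].
- by apply/asboolP; rewrite subrr; apply: ideal0.
- by apply/asboolP/asboolP => /idealN; rewrite opprB.
- move=> /asboolP xy /asboolP yz; apply/asboolP.
  by rewrite -(subrK y x) -addrA; apply: idealD.
Qed.

Canonical ideal_equiv := EquivRelPack ideal_eq_equiv.

Definition quotAlg : Type := {eq_quot ideal_equiv}.
HB.instance Definition _ := Choice.on quotAlg.

Definition qpi (x : A) : quotAlg := \pi_({eq_quot ideal_equiv}) x.
Definition qrepr (u : quotAlg) : A := repr (u : {eq_quot ideal_equiv}).

Lemma qreprK u : qpi (qrepr u) = u.
Proof. exact: reprK. Qed.

Lemma qpiP x y : qpi x = qpi y <-> J (x - y).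
Proof. by split=> [/eqmodP/asboolP|?] //; apply/eqmodP/asboolP. Qed.

Lemma qrepr_pi x : J (qrepr (qpi x) - x).
Proof. by apply/qpiP; rewrite qreprK. Qed.

Definition qadd u v := qpi (qrepr u + qrepr v).
Definition qopp u := qpi (- qrepr u).
Definition qmul u v := qpi (qrepr u * qrepr v).
Definition qscale (c : K) u := qpi (c *: qrepr u).

Lemma qpiD x y : qpi (x + y) = qadd (qpi x) (qpi y).
Proof.
apply/esym/qpiP; rewrite opprD addrACA.
by apply: idealD; apply: qrepr_pi.
Qed.

Lemma qpiN x : qpi (- x) = qopp (qpi x).
Proof. by apply/esym/qpiP; rewrite -opprD; apply/idealN/qrepr_pi. Qed.

Lemma qpiZ c x : qpi (c *: x) = qscale c (qpi x).
Proof. by apply/esym/qpiP; rewrite -scalerBr; apply/idealZ/qrepr_pi. Qed.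

Lemma qpiM x y : qpi (x * y) = qmul (qpi x) (qpi y).
Proof.
apply/esym/qpiP; rewrite -(subrK (x * qrepr (qpi y)) (_ * _)) -addrA.
rewrite -mulrBl -mulrBr; apply: idealD.
  exact/idealMr/qrepr_pi.
exact/idealMl/qrepr_pi.
Qed.

Lemma qaddA : associative qadd.
Proof.
by move=> u v w; rewrite -(qreprK u) -(qreprK v) -(qreprK w) -!qpiD addrA.
Qed.
Lemma qaddC : commutative qadd.
Proof. by move=> u v; rewrite -(qreprK u) -(qreprK v) -!qpiD addrC. Qed.
Lemma qadd0 : left_id (qpi 0) qadd.
Proof. by move=> u; rewrite -(qreprK u) -!qpiD add0r. Qed.
Lemma qaddN : left_inverse (qpi 0) qopp qadd.
Proof. by move=> u; rewrite -(qreprK u) -qpiN -qpiD addNr. Qed.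

HB.instance Definition _ :=
  GRing.isZmodule.Build quotAlg qaddA qaddC qadd0 qaddN.

Lemma qmulA : associative qmul.
Proof.
by move=> u v w; rewrite -(qreprK u) -(qreprK v) -(qreprK w) -!qpiM mulrA.
Qed.
Lemma qmul1 : left_id (qpi 1) qmul.
Proof. by move=> u; rewrite -(qreprK u) -!qpiM mul1r. Qed.
Lemma qmulr1 : right_id (qpi 1) qmul.
Proof. by move=> u; rewrite -(qreprK u) -!qpiM mulr1. Qed.
Lemma qmulDl : left_distributive qmul +%R.
Proof.
move=> u v w; rewrite -(qreprK u) -(qreprK v) -(qreprK w).
by rewrite -[_ + _]qpiD -!qpiM mulrDl qpiD.
Qed.
Lemma qmulDr : right_distributive qmul +%R.
Proof.
move=> u v w; rewrite -(qreprK u) -(qreprK v) -(qreprK w).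
by rewrite -[_ + _]qpiD -!qpiM mulrDr qpiD.
Qed.
Lemma qone_neq0 : qpi 1 != 0 :> quotAlg.
Proof. by apply/eqP => /qpiP; rewrite subr0; apply: ideal1. Qed.

HB.instance Definition _ := GRing.Zmodule_isNzRing.Build quotAlg
  qmulA qmul1 qmulr1 qmulDl qmulDr qone_neq0.

Lemma qscaleA a b u : qscale a (qscale b u) = qscale (a * b) u.
Proof. by rewrite -(qreprK u) -!qpiZ scalerA. Qed.
Lemma qscale1 : left_id 1 qscale.
Proof. by move=> u; rewrite -(qreprK u) -!qpiZ scale1r. Qed.
Lemma qscaleDr : right_distributive qscale +%R.
Proof.
move=> c u v; rewrite -(qreprK u) -(qreprK v).
by rewrite -[_ + _]qpiD -!qpiZ scalerDr qpiD.
Qed.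
Lemma qscaleDl u : {morph qscale^~ u : a b / a + b}.
Proof. by move=> a b; rewrite -(qreprK u) -!qpiZ scalerDl qpiD. Qed.

HB.instance Definition _ := GRing.Zmodule_isLmodule.Build K quotAlg
  qscaleA qscale1 qscaleDr qscaleDl.

Lemma qpi_is_zmod_morphism : zmod_morphism qpi.
Proof. by move=> x y; rewrite qpiD qpiN. Qed.
Lemma qpi_is_monoid_morphism : monoid_morphism qpi.
Proof. by split=> // x y; rewrite qpiM. Qed.
Lemma qpi_is_scalable : scalable qpi.
Proof. by move=> c x; rewrite qpiZ. Qed.
HB.instance Definition _ :=
  GRing.isZmodMorphism.Build A quotAlg qpi qpi_is_zmod_morphism.
HB.instance Definition _ :=
  GRing.isMonoidMorphism.Build A quotAlg qpi qpi_is_monoid_morphism.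
HB.instance Definition _ :=
  GRing.isScalable.Build K A quotAlg *:%R qpi qpi_is_scalable.

Lemma qscaleAl a (u v : quotAlg) : a *: (u * v) = (a *: u) * v.
Proof.
by rewrite -(qreprK u) -(qreprK v) -rmorphM -!linearZ -rmorphM /= scalerAl.
Qed.
HB.instance Definition _ := GRing.Lmodule_isLalgebra.Build K quotAlg qscaleAl.

Lemma qscaleAr a (u v : quotAlg) : a *: (u * v) = u * (a *: v).
Proof.
by rewrite -(qreprK u) -(qreprK v) -rmorphM -!linearZ -rmorphM /= scalerAr.
Qed.
HB.instance Definition _ := GRing.Lalgebra_isAlgebra.Build K quotAlg qscaleAr.

End QuotientAlgebra.

(* The free algebra K<I> on the set I, with basis the words in I.  It is the
   monoid algebra {malg K[fmonom I]}; the operations are locked to keep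
   unification from unfolding them. *)
Section FreeAlgebra.
Variables (K : fieldType) (I : choiceType).

Definition freeAlg : Type := {malg K[fmonom I]}.
HB.instance Definition _ := Choice.on freeAlg.

Definition free_add : freeAlg -> freeAlg -> freeAlg :=
  locked (@fgadd (fmonom I) K).
Definition free_opp : freeAlg -> freeAlg := locked (@fgopp (fmonom I) K).
Definition free_mul : freeAlg -> freeAlg -> freeAlg :=
  locked (@fgmul (fmonom I) K).
Definition free_scale : K -> freeAlg -> freeAlg :=
  locked (@fgscale (fmonom I) K).
Definition free_zero : freeAlg := locked (@fgzero (fmonom I) K).
Definition mono (w : seq I) : freeAlg := locked << FMonom w >>.

Definition fcoef (w : seq I) (x : freeAlg) : K :=
  locked (@mcoeff (fmonom I) K (FMonom w)) x.
Definition supp (x : freeAlg) : seq (seq I) :=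
  map (@fmonom_val I) (locked (@msupp (fmonom I) K) x).

Lemma fcoefP x y : (forall w, fcoef w x = fcoef w y) -> x = y.
Proof.
by move=> H; apply/malgP => -[w]; have := H w; rewrite /fcoef -!lock.
Qed.

Lemma fcoef_addE w x y : fcoef w (free_add x y) = fcoef w x + fcoef w y.
Proof. by rewrite /fcoef /free_add -!lock fgaddE. Qed.
Lemma fcoef_oppE w x : fcoef w (free_opp x) = - fcoef w x.
Proof. by rewrite /fcoef /free_opp -!lock fgoppE. Qed.
Lemma fcoef_zeroE w : fcoef w free_zero = 0.
Proof. by rewrite /fcoef /free_zero -!lock fgzeroE. Qed.
Lemma fcoef_scaleE w c x : fcoef w (free_scale c x) = c * fcoef w x.
Proof. by rewrite /fcoef /free_scale -!lock fgscaleE. Qed.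
Lemma fcoef_mono v w : fcoef v (mono w) = (v == w)%:R.
Proof. by rewrite /fcoef /mono -!lock mcoeffU eq_sym. Qed.

Lemma free_addA : associative free_add.
Proof. by move=> x y z; apply/fcoefP => w; rewrite !fcoef_addE addrA. Qed.
Lemma free_addC : commutative free_add.
Proof. by move=> x y; apply/fcoefP => w; rewrite !fcoef_addE addrC. Qed.
Lemma free_add0 : left_id free_zero free_add.
Proof. by move=> x; apply/fcoefP => w; rewrite fcoef_addE fcoef_zeroE add0r. Qed.
Lemma free_addN : left_inverse free_zero free_opp free_add.
Proof.
by move=> x; apply/fcoefP => w; rewrite fcoef_addE fcoef_oppE fcoef_zeroE addNr.
Qed.
HB.instance Definition _ :=
  GRing.isZmodule.Build freeAlg free_addA free_addC free_add0 free_addN.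

Lemma free_mulA : associative free_mul.
Proof. by rewrite /free_mul -lock; apply: fgmulA. Qed.
Lemma mono_scaleE c w : free_scale c (mono w) = << c *g FMonom w >>.
Proof.
apply/fcoefP => v; rewrite fcoef_scaleE fcoef_mono /fcoef -lock mcoeffU.
by rewrite mulr_natr eq_sym.
Qed.
Lemma mono_mulE c d v w :
  free_mul (free_scale c (mono v)) (free_scale d (mono w))
    = free_scale (c * d) (mono (v ++ w)).
Proof.
rewrite !mono_scaleE /free_mul -lock; apply: etrans (fgmulUU _ _ _ _) _.
by congr << _ *g _ >>; apply/eqP; rewrite fmP fmM.
Qed.
Lemma free_mul1 : left_id (mono [::]) free_mul.
Proof.
by rewrite /free_mul /mono -!lock -fmoneE; apply: fgmul1g.
Qed.
Lemma free_mulr1 : right_id (mono [::]) free_mul.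
Proof.
by rewrite /free_mul /mono -!lock -fmoneE; apply: fgmulg1.
Qed.
Lemma free_mulDl : left_distributive free_mul +%R.
Proof.
move=> x y z; change (free_mul (free_add x y) z = free_add (free_mul x z) (free_mul y z)).
by rewrite /free_mul /free_add -!lock; apply: fgmulgDl.
Qed.
Lemma free_mulDr : right_distributive free_mul +%R.
Proof.
move=> x y z; change (free_mul x (free_add y z) = free_add (free_mul x y) (free_mul x z)).
by rewrite /free_mul /free_add -!lock; apply: fgmulgDr.
Qed.
Lemma free_one_neq0 : mono [::] != 0.
Proof.
apply/eqP => /(congr1 (fcoef [::])); rewrite fcoef_mono eqxx fcoef_zeroE.
by move/eqP; rewrite oner_eq0.
Qed.
HB.instance Definition _ := GRing.Zmodule_isNzRing.Build freeAlg
  free_mulA free_mul1 free_mulr1 free_mulDl free_mulDr free_one_neq0.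

Lemma free_scaleA a b x : free_scale a (free_scale b x) = free_scale (a * b) x.
Proof. by apply/fcoefP => w; rewrite !fcoef_scaleE mulrA. Qed.
Lemma free_scale1 : left_id 1 free_scale.
Proof. by move=> x; apply/fcoefP => w; rewrite fcoef_scaleE mul1r. Qed.
Lemma free_scaleDr : right_distributive free_scale +%R.
Proof.
by move=> a x y; apply/fcoefP => w;
  rewrite !(fcoef_scaleE, fcoef_addE) mulrDr.
Qed.
Lemma free_scaleDl x : {morph free_scale^~ x : a b / a + b}.
Proof.
by move=> a b; apply/fcoefP => w; rewrite !(fcoef_scaleE, fcoef_addE) mulrDl.
Qed.
HB.instance Definition _ := GRing.Zmodule_isLmodule.Build K freeAlg
  free_scaleA free_scale1 free_scaleDr free_scaleDl.

Lemma fcoefD w x y : fcoef w (x + y) = fcoef w x + fcoef w y.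
Proof. exact: fcoef_addE. Qed.
Lemma fcoefZ w c x : fcoef w (c *: x) = c * fcoef w x.
Proof. exact: fcoef_scaleE. Qed.
Lemma fcoef0 w : fcoef w 0 = 0.
Proof. exact: fcoef_zeroE. Qed.
Lemma fcoef_sum w (J : Type) (r : seq J) (P : pred J) (F : J -> freeAlg) :
  fcoef w (\sum_(k <- r | P k) F k) = \sum_(k <- r | P k) fcoef w (F k).
Proof. exact: (big_morph (fcoef w) (fcoefD w) (fcoef0 w)). Qed.

Lemma monoZM c d v w :
  (c *: mono v) * (d *: mono w) = (c * d) *: mono (v ++ w).
Proof. exact: mono_mulE. Qed.
Lemma monoM v w : mono v * mono w = mono (v ++ w).
Proof. by rewrite -[mono v]scale1r -[mono w]scale1r monoZM mulr1 !scale1r. Qed.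
Lemma mono1 : mono [::] = 1.
Proof. by []. Qed.

Lemma mem_supp w x : (w \in supp x) = (fcoef w x != 0).
Proof.
rewrite /supp /fcoef -!lock mcoeff_neq0; apply/mapP/idP => [[[v] vx ->]|wx] //.
by exists (FMonom w).
Qed.

Lemma supp_uniq x : uniq (supp x).
Proof. by rewrite map_inj_uniq ?fset_uniq // => -[v] [w] /= ->. Qed.

Lemma freeE x : x = \sum_(w <- supp x) fcoef w x *: mono w.
Proof.
apply/fcoefP => v; rewrite fcoef_sum.
under eq_bigr => w _ do rewrite fcoefZ fcoef_mono.
have [vx|vx] := boolP (v \in supp x).
  rewrite (bigD1_seq v) ?supp_uniq //= eqxx mulr1 big1 ?addr0 // => w.
  by rewrite eq_sym => /negbTE ->; rewrite mulr0.
rewrite big_seq big1 => [|w wx]; first by move: vx; rewrite mem_supp => /negPn/eqP.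
by case: eqP => [vw|]; rewrite ?mulr0 //; rewrite vw wx in vx.
Qed.

Lemma free_ind (P : freeAlg -> Prop) :
  P 0 -> (forall x y, P x -> P y -> P (x + y)) ->
  (forall c w, P (c *: mono w)) -> forall x, P x.
Proof. by move=> P0 PD PU x; rewrite (freeE x); apply: big_ind. Qed.

Lemma free_scaleAl a (x y : freeAlg) : a *: (x * y) = (a *: x) * y.
Proof.
elim/free_ind: x => [|x1 x2 IH1 IH2|c v].
- by rewrite !(mul0r, scaler0).
- by rewrite !(mulrDl, scalerDr) IH1 IH2.
elim/free_ind: y => [|y1 y2 IH1 IH2|d w].
- by rewrite !(mulr0, scaler0).
- by rewrite !(mulrDr, scalerDr) IH1 IH2.
by rewrite !(scalerA, monoZM) mulrA.
Qed.
HB.instance Definition _ := GRing.Lmodule_isLalgebra.Build K freeAlg free_scaleAl.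

Lemma free_scaleAr a (x y : freeAlg) : a *: (x * y) = x * (a *: y).
Proof.
elim/free_ind: x => [|x1 x2 IH1 IH2|c v].
- by rewrite !(mul0r, scaler0).
- by rewrite !mulrDl scalerDr IH1 IH2.
elim/free_ind: y => [|y1 y2 IH1 IH2|d w].
- by rewrite !(mulr0, scaler0).
- by rewrite !(mulrDr, scalerDr) IH1 IH2.
by rewrite !(scalerA, monoZM) mulrCA.
Qed.
HB.instance Definition _ :=
  GRing.Lalgebra_isAlgebra.Build K freeAlg free_scaleAr.

Definition fgen (i : I) : freeAlg := mono [:: i].

Definition free_lin (V : lmodType K) (f : seq I -> V) (x : freeAlg) : V :=
  \sum_(w <- supp x) fcoef w x *: f w.

Section FreeLin.
Variables (V : lmodType K) (f : seq I -> V).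

Lemma free_linE (x : freeAlg) (r : seq (seq I)) : uniq r ->
  {subset supp x <= r} -> free_lin f x = \sum_(w <- r) fcoef w x *: f w.
Proof.
move=> ur sr; rewrite /free_lin [RHS](bigID (mem (supp x))) /=.
rewrite [X in _ = _ + X]big1 ?addr0; last first.
  by move=> w; rewrite mem_supp negbK => /eqP ->; rewrite scale0r.
rewrite -[RHS]big_filter; apply/perm_big/uniq_perm; rewrite ?supp_uniq ?filter_uniq //.
by move=> w; rewrite mem_filter; case: (boolP (w \in supp x)) => //= /sr.
Qed.

Lemma free_lin_linear : linear (free_lin f).
Proof.
move=> a x y; pose r := undup (supp (a *: x + y) ++ supp x ++ supp y).
have ur : uniq r by apply: undup_uniq.
rewrite !(free_linE (r := r)) // => [|w|w|w]; rewrite ?mem_undup ?mem_cat.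
- rewrite scaler_sumr -big_split; apply: eq_bigr => w _ /=.
  by rewrite fcoefD fcoefZ scalerDl scalerA.
- by move=> ->; rewrite !orbT.
- by move=> ->; rewrite !orbT.
- by move=> ->.
Qed.

HB.instance Definition _ := GRing.isLinear.Build K freeAlg V *:%R
  (free_lin f) free_lin_linear.

Lemma free_lin_mono w : free_lin f (mono w) = f w.
Proof.
rewrite (free_linE (r := [:: w])) // ?big_seq1 ?fcoef_mono ?eqxx ?scale1r //.
by move=> v; rewrite mem_supp fcoef_mono inE; case: (v == w); rewrite ?eqxx.
Qed.

End FreeLin.

End FreeAlgebra.

Inductive ideal_gen (K : fieldType) (A : algType K) (S : A -> Prop) :
    A -> Prop :=
  | ideal_gen0 : ideal_gen S 0
  | ideal_genD x y :
      ideal_gen S x -> ideal_gen S y -> ideal_gen S (x + y)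
  | ideal_gen_in x s y : S s -> ideal_gen S (x * s * y).

Section IdealGen.
Variables (K : fieldType) (A : algType K) (S : A -> Prop).

Lemma ideal_genMl x y : ideal_gen S y -> ideal_gen S (x * y).
Proof.
elim=> [|y1 y2 _ IH1 _ IH2|u s v Ss].
- by rewrite mulr0; apply: ideal_gen0.
- by rewrite mulrDr; apply: ideal_genD.
- by rewrite !mulrA; apply: ideal_gen_in.
Qed.

Lemma ideal_genMr x y : ideal_gen S x -> ideal_gen S (x * y).
Proof.
elim=> [|y1 y2 _ IH1 _ IH2|u s v Ss].
- by rewrite mul0r; apply: ideal_gen0.
- by rewrite mulrDl; apply: ideal_genD.
- by rewrite -mulrA; apply: ideal_gen_in.
Qed.

End IdealGen.

Section QuantumAlgebra.
Variables (R : realType) (g : simpleLie R) (K : fieldType) (q : K).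

(* For i != j the Cartan integer a_ij is nonpositive, so that
   serre_deg i j = 1 - a_ij. *)
Definition serre_deg (i j : Pi g) : nat := `|1 - cartan i j|%N.

Definition serre (i j : Pi g) : freeAlg K (Pi g) :=
  \sum_(k < (serre_deg i j).+1)
    ((-1) ^+ k * qbin (qroot q i) (serre_deg i j) k) *:
      (fgen K i ^+ k * fgen K j * fgen K i ^+ (serre_deg i j - k)).

Definition serre_rel (x : freeAlg K (Pi g)) : Prop :=
  exists i j, i != j /\ x = serre i j.

Definition augm : freeAlg K (Pi g) -> K^o :=
  free_lin (fun w => (w == [::])%:R : K^o).

Lemma augmM x y : augm (x * y) = augm x * augm y.
Proof.
elim/free_ind: x => [|x1 x2 IH1 IH2|a v].
- by rewrite mul0r /augm !linear0 mul0r.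
- by rewrite mulrDl /augm !linearD /= -!/(augm _) IH1 IH2 mulrDl.
elim/free_ind: y => [|y1 y2 IH1 IH2|b w].
- by rewrite mulr0 /augm !linear0 mulr0.
- by rewrite mulrDr /augm !linearD /= -!/(augm _) IH1 IH2 mulrDr.
rewrite monoZM /augm !linearZ /= !free_lin_mono.
by case: v w => [|? ?] [|? ?]; rewrite ?(scaler0, mulr0, mul0r) // /GRing.scale /= !mulr1.
Qed.

Lemma serre_ideal_proper : ~ ideal_gen serre_rel 1.
Proof.
suff H x : ideal_gen serre_rel x -> augm x = 0.
  by move=> /H/eqP; rewrite -mono1 /augm free_lin_mono oner_eq0.
have gen0 j : augm (fgen K j) = 0 by rewrite /augm free_lin_mono.
elim=> [|y1 y2 _ IH1 _ IH2|u s v [i [j [_ ->]]]].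
- by rewrite /augm linear0.
- by rewrite /augm linearD /= -!/(augm _) IH1 IH2 addr0.
rewrite !augmM /serre [augm (\sum_(_ < _) _)]linear_sum /= big1.
  by rewrite mulr0 mul0r.
by move=> k _; rewrite linearZ /= -!/(augm _) !augmM gen0 !(mulr0, mul0r, scaler0).
Qed.

Definition serre_ideal : properIdeal (freeAlg K (Pi g)) :=
  ProperIdeal (ideal_gen0 _) (@ideal_genD _ _ _)
    (@ideal_genMl _ _ serre_rel) (@ideal_genMr _ _ serre_rel)
    serre_ideal_proper.

(* The algebras U_q^+(g) and U_q^-(g) have the same presentation: the class
   of fgen K i is E_i in the former and F_i in the latter.  They only differ
   in their grading by the root lattice, see wt below. *)
Definition Uq : Type := quotAlg serre_ideal.
HB.instance Definition _ := GRing.Algebra.on Uq.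

End QuantumAlgebra.

Section FreeTwist.
Variables (K : fieldType) (I : choiceType) (Q : zmodType).
Variables (wt : I -> Q) (p : cocycle Q K).

Local Notation F := (freeAlg K I).

Definition word_wt (w : seq I) : Q := \sum_(i <- w) wt i.

Lemma word_wt_cat v w : word_wt (v ++ w) = word_wt v + word_wt w.
Proof. exact: big_cat. Qed.

Lemma word_wt_nil : word_wt [::] = 0.
Proof. exact: big_nil. Qed.

Definition homog (c : Q) (x : F) : Prop :=
  forall w, fcoef w x != 0 -> word_wt w = c.

(* The bilinear product with v * w = p(wt v, wt w) vw on words v and w. *)
Definition free_twist (x y : F) : F :=
  free_lin (fun v =>
    free_lin (fun w => p (word_wt v) (word_wt w) *: mono K (v ++ w)) y) x.

Lemma free_twistDl x y z :
  free_twist (x + y) z = free_twist x z + free_twist y z.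
Proof. exact: linearD. Qed.

Lemma free_twistZl a x y : free_twist (a *: x) y = a *: free_twist x y.
Proof. exact: linearZ. Qed.

Lemma free_twistDr x y z :
  free_twist x (y + z) = free_twist x y + free_twist x z.
Proof.
rewrite /free_twist /free_lin -big_split; apply: eq_bigr => v _ /=.
by rewrite -scalerDr; congr (_ *: _); exact: (linearD (free_lin _)).
Qed.

Lemma free_twistZr a x y : free_twist x (a *: y) = a *: free_twist x y.
Proof.
rewrite /free_twist /free_lin scaler_sumr; apply: eq_bigr => v _ /=.
by rewrite [RHS]scalerA [a * _]mulrC -scalerA; congr (_ *: _); exact: (linearZZ (free_lin (fun w => p (word_wt v) (word_wt w) *: mono K (v ++ w)))).
Qed.

Lemma free_twist0l y : free_twist 0 y = 0.
Proof. exact: linear0. Qed.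

Lemma free_twist0r x : free_twist x 0 = 0.
Proof. by rewrite -[X in free_twist _ X](scale0r (0 : F)) free_twistZr scale0r. Qed.

Lemma free_twist_mono a v b w :
  free_twist (a *: mono K v) (b *: mono K w)
    = (p (word_wt v) (word_wt w) * (a * b)) *: mono K (v ++ w).
Proof.
rewrite free_twistZl free_twistZr /free_twist !free_lin_mono !scalerA.
by congr (_ *: _); ring.
Qed.

Lemma free_twistA : associative free_twist.
Proof.
move=> x y z; elim/free_ind: x => [|x1 x2 IH1 IH2|a u].
- by rewrite !free_twist0l.
- by rewrite !free_twistDl IH1 IH2.
elim/free_ind: y => [|y1 y2 IH1 IH2|b v].
- by rewrite !(free_twist0l, free_twist0r).
- by rewrite !(free_twistDl, free_twistDr) IH1 IH2.
elim/free_ind: z => [|z1 z2 IH1 IH2|c w].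
- by rewrite !free_twist0r.
- by rewrite !free_twistDr IH1 IH2.
rewrite !free_twist_mono !word_wt_cat catA; congr (_ *: _).
have := cocycleP p (word_wt u) (word_wt v) (word_wt w).
set p1 := p _ _; set p2 := p _ _; set p3 := p _ _; set p4 := p _ _ => pE.
by transitivity (p3 * p4 * (a * b * c)); [ring | rewrite -pE; ring].
Qed.

Definition free_twist1 : F := (p 0 0)^-1 *: 1.

Lemma free_twist1l : left_id free_twist1 free_twist.
Proof.
move=> x; rewrite /free_twist1 -mono1; elim/free_ind: x => [|x1 x2 IH1 IH2|a u].
- by rewrite free_twist0r.
- by rewrite free_twistDr IH1 IH2.
rewrite free_twist_mono word_wt_nil cocycle0l mulrA mulfV ?mul1r //.
exact: cocycle_neq0.
Qed.

Lemma free_twist1r : right_id free_twist1 free_twist.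
Proof.
move=> x; rewrite /free_twist1 -mono1; elim/free_ind: x => [|x1 x2 IH1 IH2|a u].
- by rewrite free_twist0l.
- by rewrite free_twistDl IH1 IH2.
rewrite free_twist_mono word_wt_nil cocycle0r cats0 mulrCA mulfV ?mulr1 //.
exact: cocycle_neq0.
Qed.

Lemma homog0 c : homog c 0.
Proof. by move=> v; rewrite fcoef0 eqxx. Qed.

Lemma homogD c x y : homog c x -> homog c y -> homog c (x + y).
Proof.
move=> hx hy w; rewrite fcoefD.
by have [->|/hx //] := eqVneq (fcoef w x) 0; rewrite add0r => /hy.
Qed.

Lemma homogZ c a x : homog c x -> homog c (a *: x).
Proof. by move=> hx w; rewrite fcoefZ mulf_eq0 negb_or => /andP[_ /hx]. Qed.

Lemma homog_mono w : homog (word_wt w) (mono K w).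
Proof. by move=> v; rewrite fcoef_mono; case: (v =P w) => [->//|]; rewrite eqxx. Qed.

Lemma homog_sum c (T : Type) (r : seq T) (P : pred T) (f : T -> F) :
  (forall k, P k -> homog c (f k)) -> homog c (\sum_(k <- r | P k) f k).
Proof. by move=> h; apply: big_ind => //; [exact: homog0|exact: homogD]. Qed.

Lemma mul_suppE (x y : F) : x * y = \sum_(v <- supp x) \sum_(w <- supp y)
  (fcoef v x * fcoef w y) *: mono K (v ++ w).
Proof.
rewrite {1}(freeE x) mulr_suml; apply: eq_bigr => v _.
by rewrite {1}(freeE y) mulr_sumr; apply: eq_bigr => w _; rewrite monoZM.
Qed.

Lemma homogM c d x y : homog c x -> homog d y -> homog (c + d) (x * y).
Proof.
move=> hx hy; rewrite mul_suppE big_seq; apply: homog_sum => v.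
rewrite mem_supp => /hx <-; rewrite big_seq; apply: homog_sum => w.
rewrite mem_supp => /hy <-; rewrite -word_wt_cat; apply: homogZ.
exact: homog_mono.
Qed.

Lemma free_twist_homog c d x y :
  homog c x -> homog d y -> free_twist x y = p c d *: (x * y).
Proof.
move=> hx hy; rewrite mul_suppE scaler_sumr /free_twist {1}/free_lin !big_seq.
apply: eq_bigr => v; rewrite mem_supp => /hx ->.
rewrite /free_lin !scaler_sumr !big_seq; apply: eq_bigr => w.
by rewrite mem_supp => /hy ->; rewrite !scalerA; congr (_ *: _); ring.
Qed.

Section Stable.
Variable S : F -> Prop.
Hypothesis homogS : forall s, S s -> exists c, homog c s.

Lemma ideal_genZ a x : ideal_gen S x -> ideal_gen S (a *: x).
Proof. by move=> Jx; rewrite -[x]mul1r scalerAl; apply: ideal_genMl. Qed.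

Lemma ideal_gen_homog_ind (P : F -> Prop) :
  P 0 -> (forall x y, P x -> P y -> P (x + y)) ->
  (forall c x, homog c x -> ideal_gen S x -> P x) ->
  forall x, ideal_gen S x -> P x.
Proof.
move=> P0 PD PH x; elim=> [//|x1 x2 _ P1 _ P2|u s v Ss]; first exact: PD.
have [c hs] := homogS Ss.
elim/free_ind: u => [|u1 u2 IH1 IH2|a u]; first by rewrite !mul0r.
  by rewrite !mulrDl; apply: PD.
elim/free_ind: v => [|v1 v2 IH1 IH2|b v]; first by rewrite !mulr0.
  by rewrite !mulrDr; apply: PD.
apply: (PH (word_wt u + c + word_wt v)); last exact: ideal_gen_in.
by apply: homogM; [apply: homogM => //|]; apply/homogZ/homog_mono.
Qed.

Lemma ideal_gen_twistl x y : ideal_gen S x -> ideal_gen S (free_twist x y).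
Proof.
move: x; apply: ideal_gen_homog_ind => [|x1 x2 IH1 IH2|c x hx Jx].
- by rewrite free_twist0l; apply: ideal_gen0.
- by rewrite free_twistDl; apply: ideal_genD.
elim/free_ind: y => [|y1 y2 IH1 IH2|a w].
- by rewrite free_twist0r; apply: ideal_gen0.
- by rewrite free_twistDr; apply: ideal_genD.
rewrite (free_twist_homog hx (homogZ (a := a) (homog_mono (w := w)))).
exact/ideal_genZ/ideal_genMr.
Qed.

Lemma ideal_gen_twistr x y : ideal_gen S y -> ideal_gen S (free_twist x y).
Proof.
move: y; apply: ideal_gen_homog_ind => [|y1 y2 IH1 IH2|c y hy Jy].
- by rewrite free_twist0r; apply: ideal_gen0.
- by rewrite free_twistDr; apply: ideal_genD.
elim/free_ind: x => [|x1 x2 IH1 IH2|a w].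
- by rewrite free_twist0l; apply: ideal_gen0.
- by rewrite free_twistDl; apply: ideal_genD.
rewrite (free_twist_homog (homogZ (a := a) (homog_mono (w := w))) hy).
exact/ideal_genZ/ideal_genMl.
Qed.

End Stable.
End FreeTwist.

(* The vector space underlying U_{q,p}^s(g), with s = true for the sign + and
   s = false for the sign -.  Its product is twist_mul below. *)
Definition Uqp (R : realType) (g : simpleLie R) (K : fieldType) (q : K)
  (s : bool) (p : cocycle (lattice (Pi g)) K) : Type := Uq g q.
HB.instance Definition _ (R : realType) (g : simpleLie R) (K : fieldType)
    (q : K) (s : bool) (p : cocycle (lattice (Pi g)) K) :=
  GRing.Lmodule.copy (Uqp q s p) (Uq g q).

Section TwistedQuantumAlgebra.
Variables (R : realType) (g : simpleLie R) (K : fieldType) (q : K).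
Variables (s : bool) (p : cocycle (lattice (Pi g)) K).

Definition wt (i : Pi g) : lattice (Pi g) :=
  if s then simple_root i else - simple_root i.

Definition Uq_homog (c : lattice (Pi g)) (u : Uq g q) : Prop :=
  exists x : freeAlg K (Pi g), homog wt c x /\ u = qpi (serre_ideal g q) x.

Definition twist_mul (u v : Uq g q) : Uq g q :=
  qpi (serre_ideal g q) (free_twist wt p (qrepr u) (qrepr v)).

Definition twist_one : Uq g q := (p 0 0)^-1 *: 1.

Lemma homog_gen i : homog wt (wt i) (fgen K i).
Proof. by have := @homog_mono K _ _ wt [:: i]; rewrite /word_wt big_seq1. Qed.

Lemma homog_genX i n : homog wt (wt i *+ n) (fgen K i ^+ n).
Proof.
elim: n => [|n IH].
  by rewrite mulr0n expr0 -(word_wt_nil wt) -mono1; apply: homog_mono.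
by rewrite mulrS exprS; apply: homogM; [exact: homog_gen | exact: IH].
Qed.

Lemma serre_homog x : serre_rel q x -> exists c, homog wt c x.
Proof.
move=> [i [j [_ ->]]]; exists (wt i *+ serre_deg i j + wt j).
rewrite /serre; apply: big_ind => [||k _].
- exact: homog0.
- by move=> *; apply: homogD.
apply: homogZ; rewrite -{1}(@subnKC k (serre_deg i j)); last by rewrite -ltnS.
rewrite mulrnDr addrAC; apply: homogM; last exact: homog_genX.
by apply: homogM; [exact: homog_genX | exact: homog_gen].
Qed.

Lemma qpi_twist x y : qpi (serre_ideal g q) (free_twist wt p x y)
  = twist_mul (qpi _ x) (qpi _ y).
Proof.
apply/esym/qpiP; set x' := qrepr _; set y' := qrepr _.
have -> : free_twist wt p x' y' - free_twist wt p x y =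
    free_twist wt p (x' - x) y' + free_twist wt p x (y' - y).
  rewrite free_twistDl free_twistDr -!scaleN1r free_twistZl free_twistZr.
  by rewrite addrA; congr (_ + _); rewrite scaleN1r subrK.
apply: idealD.
  apply: (@ideal_gen_twistl _ _ _ wt p (@serre_rel _ g _ q)).
    exact: serre_homog.
  exact: (qrepr_pi (serre_ideal g q) x).
apply: (@ideal_gen_twistr _ _ _ wt p (@serre_rel _ g _ q)).
  exact: serre_homog.
exact: (qrepr_pi (serre_ideal g q) y).
Qed.

Lemma twist_mul_homog c1 c2 u1 u2 : Uq_homog c1 u1 -> Uq_homog c2 u2 ->
  twist_mul u1 u2 = p c1 c2 *: (u1 * u2).
Proof.
move=> [x1 [h1 ->]] [x2 [h2 ->]].
by rewrite -qpi_twist (free_twist_homog p h1 h2) qpiZ qpiM.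
Qed.

Lemma twist_mulA : associative twist_mul.
Proof.
move=> u v w; rewrite -(qreprK u) -(qreprK v) -(qreprK w).
rewrite -(qpi_twist (qrepr u) (qrepr v)) -(qpi_twist (qrepr v) (qrepr w)).
by rewrite -(qpi_twist (qrepr u)) -(qpi_twist _ (qrepr w)) free_twistA.
Qed.
Lemma twist_mul1 : left_id twist_one twist_mul.
Proof.
move=> u; rewrite -(qreprK u) /twist_one -[1](rmorph1 (qpi _)) -linearZ /=.
by rewrite -qpi_twist free_twist1l.
Qed.
Lemma twist_mulr1 : right_id twist_one twist_mul.
Proof.
move=> u; rewrite -(qreprK u) /twist_one -[1](rmorph1 (qpi _)) -linearZ /=.
by rewrite -qpi_twist free_twist1r.
Qed.
Lemma twist_mulDl : left_distributive twist_mul +%R.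
Proof.
move=> u v w; rewrite -(qreprK u) -(qreprK v) -(qreprK w).
by rewrite -raddfD -!qpi_twist free_twistDl raddfD.
Qed.
Lemma twist_mulDr : right_distributive twist_mul +%R.
Proof.
move=> u v w; rewrite -(qreprK u) -(qreprK v) -(qreprK w).
by rewrite -raddfD -!qpi_twist free_twistDr raddfD.
Qed.
Lemma twist_one_neq0 : twist_one != 0.
Proof. by rewrite scaler_eq0 invr_eq0 (negbTE (cocycle_neq0 _ _ _)) oner_eq0. Qed.
Lemma twist_scaleAl a u v : a *: twist_mul u v = twist_mul (a *: u) v.
Proof.
have E c x : c *: qpi (serre_ideal g q) x = qpi (serre_ideal g q) (c *: x).
  by rewrite linearZ.
rewrite -(qreprK u) -(qreprK v) -(qpi_twist (qrepr u) (qrepr v)) !E.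
by rewrite -(qpi_twist (a *: qrepr u)) free_twistZl.
Qed.
Lemma twist_scaleAr a u v : a *: twist_mul u v = twist_mul u (a *: v).
Proof.
have E c x : c *: qpi (serre_ideal g q) x = qpi (serre_ideal g q) (c *: x).
  by rewrite linearZ.
rewrite -(qreprK u) -(qreprK v) -(qpi_twist (qrepr u) (qrepr v)) !E.
by rewrite -(qpi_twist _ (a *: qrepr v)) free_twistZr.
Qed.

HB.instance Definition _ := GRing.Zmodule_isNzRing.Build (Uqp q s p)
  twist_mulA twist_mul1 twist_mulr1 twist_mulDl twist_mulDr twist_one_neq0.
HB.instance Definition _ :=
  GRing.Lmodule_isLalgebra.Build K (Uqp q s p) twist_scaleAl.
HB.instance Definition _ :=
  GRing.Lalgebra_isAlgebra.Build K (Uqp q s p) twist_scaleAr.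

Lemma Uqp_mul_homog (c1 c2 : lattice (Pi g)) (u1 u2 : Uq g q) :
  Uq_homog c1 u1 -> Uq_homog c2 u2 ->
  (u1 : Uqp q s p) * (u2 : Uqp q s p) = p c1 c2 *: (u1 * u2).
Proof. exact: twist_mul_homog. Qed.

End TwistedQuantumAlgebra.

Definition alg_isomorphic (K : fieldType) (A B : algType K) : Prop :=
  exists f : {lrmorphism A -> B}, bijective f.

Inductive group_gen (K : fieldType) (S : K -> Prop) : K -> Prop :=
  | group_gen_in x : S x -> group_gen S x
  | group_gen1 : group_gen S 1
  | group_genM x y : group_gen S x -> group_gen S y -> group_gen S (x * y)
  | group_genV x : group_gen S x -> group_gen S x^-1.

Definition Gp (R : realType) (g : simpleLie R) (K : fieldType) (q : K)
    (p : cocycle (lattice (Pi g)) K) : K -> Prop :=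
  group_gen (fun x => x = q ^+ 2 \/ exists i j : Pi g, i != j /\
    x = q ^ (- iform g (simple_root i) (simple_root j))
          * cocycle_r p (simple_root i) (simple_root j)).

Definition group_prod (K : fieldType) (G H : K -> Prop) (x : K) : Prop :=
  exists y z, G y /\ H z /\ x = y * z.

Definition torsion_free (K : fieldType) (G : K -> Prop) : Prop :=
  forall x n, G x -> (0 < n)%N -> x ^+ n = 1 -> x = 1.

(* Main.v *)
From mathcomp Require Import fingroup perm.
Require Import Defs.
From HB Require Import structures.
From mathcomp Require Import all_boot all_order all_algebra.
From mathcomp Require Import ring zify boolp reals complex.

Set Implicit Arguments.
Unset Strict Implicit.
Unset Printing Implicit Defensive.

Import Order.TTheory GRing.Theory Num.Theory.
Local Open Scope ring_scope.

(** Write A_i for the algebra U_{q,p_i}(g_i), for either sign.  In the twisted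
    product, a word in the generators is multiplied by a product of values of
    the cocycle, and exchanging two adjacent letters changes this scalar by
    r_i.  Hence A_i is presented by its generators x_a and, for each pair
    a <> b of simple roots, one relation
      sum_k c_k x_a^k x_b x_a^(m-k) = 0,
    where by the q-binomial theorem sum_k c_k X^k is, up to a scalar, the
    polynomial with the m = 1 - a_ab distinct roots r_i(a,b) q_a^(m-1-2l),
    l < m ([twist_presented]).  All the data of the problem sit in these sets
    of roots S_i(a,b).

    If theta preserves the Cartan matrix and r, it preserves the sets of roots:
    the form is determined by the Cartan matrix because the Dynkin diagram is
    connected ([cartan_connected]) and its short roots have square length 2, so
    the q_a agree ([dynkin_iso_norm]).  The presentations then agree up to
    renaming, and so do the algebras ([serre_presented_iso]).

    Conversely let f : A_1 -> A_2 be an isomorphism ([alg_iso_roots]), and let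
    M a i be the coefficient of the generator y_a of A_2 in f(x_i).  These
    coefficients come from derivations relative to the augmentation of A_2,
    and a derivation composed with f is determined by its values on the
    generators of A_1, so the rows of M are independent.  By symmetry M is
    square and invertible, and some bijection theta has M (theta i) i <> 0 for
    all i.  Let i <> j be such that 1 is missing from one of S_1(i,j) and
    S_1(j,i).  Sending all generators but y_a to 0 maps A_2 to K[t], and in
    this commutative domain the relation says that the images of f(x_i) and
    f(x_j) have product 0; it follows that these images are 0 for a = theta j
    and a = theta i respectively.  For a root rho in S_2(theta i, theta j) the
    algebra A_2 also maps to the upper triangular matrices
      y_(theta i) |-> diag(rho t, t),  y_(theta j) |-> E_12,
    and the lowest term of the relation of A_1, evaluated there, says that rho
    is in S_1(i,j) ([tangent_roots]).  So
    S_2(theta i, theta j) is contained in S_1(i,j) for all such pairs.  The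
    genericity hypothesis says that the remaining pairs are those with
    S_1(i,j) = {1}.  The same inclusions hold for the inverse of f, and
    counting turns all of them into equalities ([theta_rootsE]).  The number
    of roots is 1 - a_ij, and their sum is r(i,j) [m]_(q_i), where [m]_(q_i)
    is a nonzero quantum integer; so the Cartan matrices agree, and so does r.

    That the Lie algebras are isomorphic once their Cartan matrices agree is
    the classical argument with the subalgebra of g_1 x g_2 generated by the
    pairs of corresponding Chevalley generators: its intersections with the
    factors are ideals, and its triangular decomposition ([triangular]) shows
    that they are proper, so that it is the graph of an isomorphism
    ([dynkin_iso_lie]).  Besides, the Lie algebras only enter through the signs
    of the Cartan integers ([cartan_le0]) and the connectedness of the
    diagram. *)

(** * Algebras presented by skew Serre relations *)

Section SkewSerre.
Variable K : fieldType.

Definition roots_poly (S : seq K) : {poly K} := \prod_(z <- S) ('X - z%:P).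

(** For S the set of roots of the q-binomial polynomial, scaled by r, this is the
    quantum Serre expression of the twisted algebra up to a nonzero scalar.
    Recording the roots instead of the coefficients makes the comparison of two
    relations a comparison of finite sets. *)
Definition skew_serre (A : algType K) (S : seq K) (u v : A) : A :=
  \sum_(k < (size S).+1)
    (roots_poly S)`_k *: (u ^+ k * v * u ^+ (size S - k)).

Lemma size_roots_poly S : size (roots_poly S) = (size S).+1.
Proof. exact: size_prod_XsubC. Qed.

Lemma root_roots_poly S z : root (roots_poly S) z = (z \in S).
Proof. exact: root_prod_XsubC. Qed.

Lemma horner_roots_poly S z :
  (roots_poly S).[z] = \sum_(k < (size S).+1) (roots_poly S)`_k * z ^+ k.
Proof. by rewrite horner_coef size_roots_poly. Qed.

(** On commuting elements the relation only sees the value of the polynomial at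
    1: this is why the presence of 1 in the set of roots decides how two
    generators interact. *)
Lemma skew_serre_comm (A : algType K) S (u v : A) : GRing.comm v u ->
  skew_serre S u v = (roots_poly S).[1] *: (u ^+ size S * v).
Proof.
move=> cuv; rewrite horner_roots_poly scaler_suml; apply: eq_bigr => k _.
rewrite expr1n mulr1 -mulrA; congr (_ *: _).
have /commrX -> := cuv; rewrite mulrA -exprD subnKC // -ltnS; exact: ltn_ord.
Qed.

Lemma skew_serre0l (A : algType K) S (v : A) : (0 < size S)%N ->
  skew_serre S 0 v = 0.
Proof.
move=> S0; apply: big1 => k _; rewrite !expr0n subn_eq0 leqNgt.
case: (nat_of_ord k =P 0%N) => [->|_]; first by rewrite S0 mulr0 scaler0.
by rewrite !mul0r scaler0.
Qed.

Lemma skew_serre0r (A : algType K) S (u : A) : skew_serre S u 0 = 0.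
Proof. by apply: big1 => k _; rewrite mulr0 mul0r scaler0. Qed.

Lemma rmorph_skew_serre (A B : algType K) (f : {lrmorphism A -> B}) S u v :
  f (skew_serre S u v) = skew_serre S (f u) (f v).
Proof.
rewrite /skew_serre linear_sum; apply: eq_bigr => k _.
by rewrite linearZ /= !rmorphM !rmorphXn.
Qed.

Definition serre_tuple (I : Type) (S : I -> I -> seq K) (A : algType K)
    (b : I -> A) : Prop :=
  forall i j, i <> j -> skew_serre (S i j) (b i) (b j) = 0.

(** Presentation by generators and relations, phrased through the universal
    property so that no quotient needs to be mentioned. *)
Record serre_presented (I : Type) (S : I -> I -> seq K) (A : algType K)
    (x : I -> A) : Prop := SerrePresented {
  presented_rel : serre_tuple S x;
  presented_lift : forall (B : algType K) (b : I -> B), serre_tuple S b ->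
    exists f : {lrmorphism A -> B}, forall i, f (x i) = b i;
  presented_ind : forall P : A -> Prop, P 1 ->
    (forall a u v, P u -> P v -> P (a *: u + v)) ->
    (forall u v, P u -> P v -> P (u * v)) ->
    (forall i, P (x i)) -> forall u, P u
}.

Lemma eq_presented I S (A B : algType K) (x : I -> A)
    (f g : {lrmorphism A -> B}) :
  serre_presented S x -> (forall i, f (x i) = g (x i)) -> f =1 g.
Proof.
move=> pA fg; apply: (presented_ind pA (P := fun u => f u = g u)) => [|a u v|u v|//].
- by rewrite !rmorph1.
- by move=> fu fv; rewrite !linearD !linearZ /= fu fv.
- by move=> fu fv; rewrite !rmorphM /= fu fv.
Qed.

Lemma serre_presented_iso (I1 I2 : Type) S1 S2 (A1 A2 : algType K)
    (x1 : I1 -> A1) (x2 : I2 -> A2) (theta : I1 -> I2) :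
  serre_presented S1 x1 -> serre_presented S2 x2 -> bijective theta ->
  (forall i j, i <> j -> S2 (theta i) (theta j) = S1 i j) ->
  alg_isomorphic A1 A2.
Proof.
move=> pA1 pA2 [eta thetaK etaK] thetaS.
have [i j ij|f fE] := presented_lift pA1 (b := x2 \o theta).
  rewrite -thetaS //=; apply: (presented_rel pA2).
  by move=> /(can_inj thetaK).
have [i j ij|g gE] := presented_lift pA2 (b := x1 \o eta).
  rewrite -{1}(etaK i) -{1}(etaK j) thetaS //=.
    by apply: (presented_rel pA1) => /(can_inj etaK).
  by move=> /(can_inj etaK).
exists f; exists g.
  apply: (eq_presented (f := g \o f) (g := idfun) pA1) => i.
  by rewrite /= fE gE /= thetaK.
apply: (eq_presented (f := f \o g) (g := idfun) pA2) => i.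
by rewrite /= gE fE /= etaK.
Qed.

End SkewSerre.

(** The pair (p, g) stands for the upper triangular matrix with diagonal
    entries p(rho t) and p(t) and upper right entry g.  With 2 x 2 matrices over
    K[t] themselves one would get an algebra over K[t], not over K. *)
Definition skewExt (K : fieldType) (rho : K) : Type := ({poly K} * {poly K})%type.
HB.instance Definition _ (K : fieldType) (rho : K) :=
  GRing.Lmodule.copy (skewExt rho) ({poly K} * {poly K})%type.

Section SkewExtension.
Variables (K : fieldType) (rho : K).
Local Notation skewExt := (skewExt rho).

Definition dilate (p : {poly K}) : {poly K} := p \Po (rho *: 'X).

Definition skew_mul (u v : skewExt) : skewExt :=
  (u.1 * v.1, dilate u.1 * v.2 + u.2 * v.1).
Definition skew_one : skewExt := (1, 0).

Lemma dilateM p r : dilate (p * r) = dilate p * dilate r.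
Proof. exact: comp_polyM. Qed.
Lemma dilateD p r : dilate (p + r) = dilate p + dilate r.
Proof. exact: comp_polyD. Qed.
Lemma dilateZ a p : dilate (a *: p) = a *: dilate p.
Proof. exact: comp_polyZ. Qed.
Lemma dilate1 : dilate 1 = 1.
Proof. exact: comp_polyC. Qed.
Lemma dilate0 : dilate 0 = 0.
Proof. exact: comp_poly0. Qed.
Lemma dilateX : dilate 'X = rho *: 'X.
Proof. exact: comp_polyX. Qed.
Lemma dilateXn p k : dilate (p ^+ k) = dilate p ^+ k.
Proof. by elim: k => [|k IH]; rewrite ?dilate1 // !exprS dilateM IH. Qed.
Lemma horner_dilate0 p : (dilate p).[0] = p.[0].
Proof. by rewrite horner_comp hornerZ hornerX mulr0. Qed.

Lemma skew_mulA : associative skew_mul.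
Proof.
move=> [a a'] [b b'] [c c']; rewrite /skew_mul /= dilateM; congr (_, _); ring.
Qed.
Lemma skew_mul1 : left_id skew_one skew_mul.
Proof. by move=> [a a']; rewrite /skew_mul /= dilate1; congr (_, _); ring. Qed.
Lemma skew_mulr1 : right_id skew_one skew_mul.
Proof. by move=> [a a']; rewrite /skew_mul /=; congr (_, _); ring. Qed.
Lemma skew_mulDl : left_distributive skew_mul +%R.
Proof.
move=> [a a'] [b b'] [c c'].
change (((a + b) * c, dilate (a + b) * c' + (a' + b') * c) =
  (a * c + b * c, dilate a * c' + a' * c + (dilate b * c' + b' * c)) :> skewExt).
by rewrite dilateD; congr (_, _); ring.
Qed.
Lemma skew_mulDr : right_distributive skew_mul +%R.
Proof.
move=> [a a'] [b b'] [c c'].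
change ((a * (b + c), dilate a * (b' + c') + a' * (b + c)) =
  (a * b + a * c, dilate a * b' + a' * b + (dilate a * c' + a' * c)) :> skewExt).
by congr (_, _); ring.
Qed.
Lemma skew_one_neq0 : skew_one != 0 :> skewExt.
Proof. by apply/eqP => -[/eqP]; rewrite oner_eq0. Qed.
HB.instance Definition _ := GRing.Zmodule_isNzRing.Build skewExt
  skew_mulA skew_mul1 skew_mulr1 skew_mulDl skew_mulDr skew_one_neq0.

Lemma skew_scaleAl a (u v : skewExt) : a *: (u * v) = (a *: u : skewExt) * v.
Proof.
case: u v => [u u'] [v v'].
change ((a *: (u * v), a *: (dilate u * v' + u' * v)) =
  ((a *: u) * v, dilate (a *: u) * v' + (a *: u') * v) :> skewExt).
by rewrite dilateZ scalerDr !scalerAl.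
Qed.
HB.instance Definition _ := GRing.Lmodule_isLalgebra.Build K skewExt skew_scaleAl.
Lemma skew_scaleAr a (u v : skewExt) : a *: (u * v) = u * (a *: v : skewExt).
Proof.
case: u v => [u u'] [v v'].
change ((a *: (u * v), a *: (dilate u * v' + u' * v)) =
  (u * (a *: v), dilate u * (a *: v') + u' * (a *: v)) :> skewExt).
by rewrite scalerDr !scalerAr.
Qed.
HB.instance Definition _ := GRing.Lalgebra_isAlgebra.Build K skewExt skew_scaleAr.

Lemma skewM (p g p' g' : {poly K}) :
  ((p, g) : skewExt) * ((p', g') : skewExt)
    = (p * p', dilate p * g' + g * p') :> skewExt.
Proof. by []. Qed.

Lemma skewX1 (u : skewExt) k : (u ^+ k).1 = u.1 ^+ k.
Proof. by elim: k => [//|k IH]; rewrite !exprS -IH. Qed.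

Lemma skew_sandwich (u : skewExt) (g : {poly K}) k l :
  u ^+ k * ((0, g) : skewExt) * u ^+ l
    = (0, dilate u.1 ^+ k * g * u.1 ^+ l) :> skewExt.
Proof.
rewrite -dilateXn -!skewX1; case: (u ^+ k) (u ^+ l) => [a a'] [b b'] /=.
by rewrite !skewM /=; congr (_, _); ring.
Qed.

Lemma skew_sum (I : Type) (r : seq I) (P : pred I) (F : I -> skewExt) :
  \sum_(i <- r | P i) F i
    = (\sum_(i <- r | P i) (F i).1, \sum_(i <- r | P i) (F i).2) :> skewExt.
Proof. by elim/big_rec3: _ => // i y1 y2 y3 _ ->; case: (F i). Qed.

(** On an off-diagonal entry the left powers of [u] act through p(rho t) and the
    right ones through p(t): the relation becomes a homogeneous polynomial in
    these two. *)
Lemma skew_serre_sandwich S (u : skewExt) (g : {poly K}) :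
  skew_serre S u ((0, g) : skewExt) =
   (0, g * \sum_(k < (size S).+1)
          (roots_poly S)`_k *: (dilate u.1 ^+ k * u.1 ^+ (size S - k)))
   :> skewExt.
Proof.
rewrite /skew_serre skew_sum; congr (_, _).
  by apply: big1 => k _; rewrite skew_sandwich; exact: scaler0.
rewrite mulr_sumr; apply: eq_bigr => k _; rewrite skew_sandwich -scalerAr.
by apply: (congr1 ( *:%R _)) => /=; ring.
Qed.

End SkewExtension.

(** * Test homomorphisms and the linear part of an isomorphism *)

(** The properties of the sets of roots on which the rigidity argument rests.
    [roots_inv] is the symmetry of the relation xy = zyx; [roots_one] is the
    form that the genericity hypothesis takes. *)
Record serre_roots (K : fieldType) (I : Type) (S : I -> I -> seq K) : Prop :=
  SerreRoots {
  roots_uniq : forall i j, i <> j -> uniq (S i j);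
  roots_gt0 : forall i j, i <> j -> (0 < size (S i j))%N;
  roots_neq0 : forall i j, i <> j -> 0 \notin S i j;
  roots_inv : forall i j z, i <> j -> S i j = [:: z] -> S j i = [:: z^-1];
  roots_one : forall i j, i <> j -> 1 \in S i j -> 1 \in S j i ->
    S i j = [:: 1]
}.

Section TestMaps.
Variables (K : fieldType) (I : eqType) (S : I -> I -> seq K).
Variables (A : algType K) (x : I -> A).
Hypotheses (Sroots : serre_roots S) (pA : serre_presented S x).

(** Every relation between two different generators contains both of them, so
    one may keep a single generator (or none, for [None]) and send the others
    to 0. *)
Lemma exists_axis_map (a : option I) : exists phi : {lrmorphism A -> {poly K}},
  forall i, phi (x i) = 'X *+ (Some i == a).
Proof.
apply: (presented_lift pA) => i j ij.
case: eqP => [<-|_]; last by rewrite mulr0n skew_serre0l // (roots_gt0 Sroots).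
by case: eqP => [[]/esym//|_]; rewrite mulr0n skew_serre0r.
Qed.

Definition axis_map a : {lrmorphism A -> {poly K}} := sval (cid (exists_axis_map a)).

Lemma axis_mapE a i : axis_map a (x i) = 'X *+ (Some i == a).
Proof. exact: (svalP (cid (exists_axis_map a))). Qed.

Definition augmentation (u : A) : K := (axis_map None u)`_0.
Definition lin_coef (a : I) (u : A) : K := (axis_map (Some a) u)`_1.

Lemma axis_map_coef0 a u : (axis_map a u)`_0 = augmentation u.
Proof.
rewrite /augmentation; apply: (presented_ind pA (P := fun u =>
  (axis_map a u)`_0 = (axis_map None u)`_0)) => [|k v w|v w|i].
- by rewrite !rmorph1.
- by move=> Hv Hw; rewrite !linearD !linearZ /= !coefD !coefZ Hv Hw.
- by move=> Hv Hw; rewrite !rmorphM /= -!horner_coef0 !hornerM !horner_coef0 Hv Hw.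
- by rewrite !axis_mapE !coefMn coefX !mul0rn.
Qed.

Lemma coefM1 (p r : {poly K}) : (p * r)`_1 = p`_0 * r`_1 + p`_1 * r`_0.
Proof. by rewrite coefM big_ord_recl big_ord1 subn0. Qed.

Lemma lin_coefM a u v :
  lin_coef a (u * v)
    = augmentation u * lin_coef a v + lin_coef a u * augmentation v.
Proof. by rewrite /lin_coef rmorphM coefM1 !axis_map_coef0. Qed.

Lemma lin_coef1 a : lin_coef a 1 = 0.
Proof. by rewrite /lin_coef rmorph1 coef1. Qed.

Lemma lin_coefD a u v : lin_coef a (u + v) = lin_coef a u + lin_coef a v.
Proof. by rewrite /lin_coef linearD coefD. Qed.

Lemma lin_coefZ a k u : lin_coef a (k *: u) = k * lin_coef a u.
Proof. by rewrite /lin_coef linearZ coefZ. Qed.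

Lemma lin_coef_gen a i : lin_coef a (x i) = (i == a)%:R.
Proof. by rewrite /lin_coef axis_mapE coefMn coefX. Qed.

Lemma scaleXn_mul (z : K) k m : (k <= m)%N ->
  (z *: 'X) ^+ k * 'X^(m - k) = z ^+ k *: 'X^m.
Proof. by move=> km; rewrite exprZn -scalerAl -exprD subnKC. Qed.

(** The relation for (a, b) holds because rho is one of its roots, and the one
    for (b, a) because the image of the b-th generator squares to 0, unless that
    relation has degree 1 in b; in this case rho is the inverse of its root. *)
Lemma exists_plane_map a b rho : a <> b -> rho \in S a b ->
  exists pi : {lrmorphism A -> skewExt rho}, forall i,
    pi (x i) = (if i == a then ('X, 0) else if i == b then (0, 1) else 0)
      :> skewExt rho.
Proof.
move=> ab rhoS; have ba : b <> a by move/esym.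
have rho0 : rho != 0.
  by apply: contraNneq (roots_neq0 Sroots ab) => <-.
apply: (presented_lift pA) => i j ij.
case: (i =P a) => [ia|ia].
  (* the relation for (a, b): it evaluates to its polynomial at rho *)
  subst i; case: (j =P a) => [/esym//|ja].
  case: (j =P b) => [jb|jb]; last by rewrite skew_serre0r.
  subst j; rewrite skew_serre_sandwich dilateX; congr (_, _).
  rewrite mul1r; transitivity ((roots_poly (S a b)).[rho] *: 'X^(size (S a b))).
    rewrite horner_roots_poly scaler_suml; apply: eq_bigr => k _.
    by rewrite scaleXn_mul ?scalerA // -ltnS.
  move: rhoS; rewrite -root_roots_poly => /rootP ->; exact: scale0r.
case: (i =P b) => [ib|ib]; last by rewrite skew_serre0l ?(roots_gt0 Sroots).
subst i; case: (j =P a) => [ja|ja]; last first.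
  by case: (j =P b) => [/esym//|_]; rewrite skew_serre0r.
(* the relation for (b, a) *)
subst j; have sq0 : ((0, 1) : skewExt rho) ^+ 2 = 0.
  by rewrite expr2 skewM; congr (_, _); rewrite ?dilate0; ring.
have := roots_gt0 Sroots ba; have := roots_inv Sroots ba.
case: (S b a) => [//|z [|z' s]] inv _.
  move: rhoS; rewrite (inv z) // inE => /eqP rhoE.
  rewrite /skew_serre /roots_poly big_seq1 big_ord_recr big_ord1 /=.
  rewrite !subn0 subnn !expr0 !expr1 !mulr1 !mul1r !skewM !coefB !coefX !coefC /=.
  rewrite !dilate0 dilateX !(mul0r, mulr0, mulr1, mul1r, add0r, addr0, subr0).
  rewrite scale1r.
  change ((- z *: 0 + 0, - z *: (rho *: 'X) + 'X) = (0, 0) :> skewExt rho).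
  congr (_, _); first by rewrite scaler0 addr0.
  rewrite scalerA mulNr rhoE mulfV ?scaleN1r ?addNr //.
  by apply: contraNneq rho0 => z0; rewrite rhoE z0 invr0.
(* in degree at least 2, every term contains the square of the image of b, or
   is the product b a b, which also vanishes *)
apply: big1 => k _; have [k2|k2] := ltnP 1 k.
  by rewrite -(subnK k2) exprD sq0 mulr0 !mul0r scaler0.
have [l2|l2] := ltnP 1 (size [:: z, z' & s] - k).
  by rewrite -(subnK l2) exprD sq0 !mulr0 scaler0.
have [-> ->] : nat_of_ord k = 1%N /\ (size [:: z, z' & s] - k = 1)%N.
  by move: k2 l2 => /=; lia.
suff -> : ((0, 1) : skewExt rho) * ('X, 0) * (0, 1) = 0 by rewrite scaler0.
by rewrite !skewM !mul0r !dilate0; congr (_, _); ring.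
Qed.

(** Compares the triangular matrices with the maps to K[t]: the diagonal only
    sees the a-th generator, and the constant term of the off-diagonal entry is
    the coefficient of the b-th one. *)
Lemma plane_map_coefs a b rho (pi : {lrmorphism A -> skewExt rho}) : a <> b ->
  (forall i, pi (x i) =
     (if i == a then ('X, 0) else if i == b then (0, 1) else 0)
       :> skewExt rho) ->
  forall u, (pi u).1 = axis_map (Some a) u /\ ((pi u).2)`_0 = lin_coef b u.
Proof.
move=> ab piE; apply: (presented_ind pA) => [|k v w [v1 v2] [w1 w2]|
    v w [v1 v2] [w1 w2]|i].
- by rewrite !rmorph1 lin_coef1 coef0.
- have -> : pi (k *: v + w) = k *: pi v + pi w by rewrite linearD linearZ.
  have -> : axis_map (Some a) (k *: v + w)
      = k *: axis_map (Some a) v + axis_map (Some a) w by rewrite linearD linearZ.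
  rewrite lin_coefD lin_coefZ -v1 -w1 -v2 -w2.
  case: (pi v) (pi w) => [p g] [p' g']; split; first by [].
  change ((k *: g + g')`_0 = k * g`_0 + g'`_0).
  by rewrite coefD coefZ.
- have -> : pi (v * w) = pi v * pi w by rewrite rmorphM.
  have -> : axis_map (Some a) (v * w) = axis_map (Some a) v * axis_map (Some a) w.
    by rewrite rmorphM.
  rewrite lin_coefM -v2 -w2 -!(axis_map_coef0 (Some a)) -v1 -w1.
  case: (pi v) (pi w) => [p g] [p' g']; rewrite skewM /=; split=> //.
  rewrite -!horner_coef0 hornerD !hornerM horner_dilate0; ring.
- rewrite piE axis_mapE lin_coef_gen.
  have -> : (Some i == Some a) = (i == a) by apply/eqP/eqP => [[]|->].
  case: eqP => [->|_] /=.
    by case: eqP => // _; rewrite coef0.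
  by case: eqP => _ /=; rewrite ?coef1 ?coef0.
Qed.

End TestMaps.

Section IsoRoots.
Variables (K : fieldType) (I1 I2 : eqType).
Variables (S1 : I1 -> I1 -> seq K) (S2 : I2 -> I2 -> seq K).
Variables (A1 A2 : algType K) (x1 : I1 -> A1) (x2 : I2 -> A2).
Hypotheses (S1roots : serre_roots S1) (S2roots : serre_roots S2).
Hypotheses (pA1 : serre_presented S1 x1) (pA2 : serre_presented S2 x2).
Variable f : {lrmorphism A1 -> A2}.

Local Notation phi := (axis_map S2roots pA2).

Definition tangent (a : I2) (i : I1) : K := lin_coef S2roots pA2 a (f (x1 i)).

(** In the domain K[t] the relation reads P(1) u^m v = 0, with P(1) nonzero. *)
Lemma axis_mapM_eq0 a i j : i <> j -> 1 \notin S1 i j ->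
  phi a (f (x1 i)) * phi a (f (x1 j)) = 0.
Proof.
move=> ij Sij; have := congr1 (phi a \o f) (presented_rel pA1 ij).
rewrite /= !rmorph_skew_serre !rmorph0 skew_serre_comm; last exact: mulrC.
move/eqP; rewrite scaler_eq0 -[_.[1] == 0]/(root _ 1) root_roots_poly (negbTE Sij) /=.
rewrite mulf_eq0 expf_eq0 => /orP[/andP[_ /eqP->]|/eqP->]; first exact: mul0r.
exact: mulr0.
Qed.

(** If p = ct + ... with c nonzero, then p(rho t) = rho ct + ..., so the lowest
    term of the homogeneous expression is (ct)^m times its value at (rho, 1). *)
Lemma dilate_sum_eq0 rho m (c : nat -> K) (p : {poly K}) :
  p`_0 = 0 -> p`_1 != 0 ->
  \sum_(k < m.+1) c k *: (dilate rho p ^+ k * p ^+ (m - k)) = 0 ->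
  \sum_(k < m.+1) c k * rho ^+ k = 0.
Proof.
move=> p0 p1 H; have [r pE] : exists r, p = r * 'X.
  have /factor_theorem[r ->] : root p 0 by rewrite /root horner_coef0 p0.
  by exists r; rewrite subr0.
have r0 : r.[0] != 0 by rewrite horner_coef0; move: p1; rewrite pE coefMX.
have : 'X^m * \sum_(k < m.+1) (c k * rho ^+ k) *:
    (dilate rho r ^+ k * r ^+ (m - k)) = 0.
  rewrite -[RHS]H mulr_sumr; apply: eq_bigr => k _.
  rewrite pE dilateM dilateX -scalerAr -scalerA; congr (_ *: _).
  have km : (k <= m)%N by rewrite -ltnS ltn_ord.
  rewrite -scalerAr exprZn -scalerAl; congr (_ *: _).
  by rewrite !exprMn -{1}(subnKC km) exprD; ring.
move/eqP; rewrite mulf_eq0 expf_eq0 polyX_eq0 andbF /= => /eqP/(congr1 (horner^~ 0)).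
rewrite horner0 horner_sum => Hs; apply: (mulIf (expf_neq0 m r0)).
rewrite mul0r -[RHS]Hs mulr_suml; apply: eq_bigr => k _.
rewrite hornerZ hornerM !horner_exp horner_dilate0 -exprD subnKC //.
by rewrite -ltnS ltn_ord.
Qed.

(** The heart of the argument.  On the axes a and b the images of f(x_i) and
    f(x_j) have product 0, so f(x_j) vanishes on the axis a and f(x_i) on the
    axis b.  The latter shows that f(x_i) has constant term 0; hence under the
    triangular representation f(x_i) has diagonal p(rho t), p(t) with p of order
    exactly 1, and f(x_j) is strictly triangular and nonzero. *)
Lemma tangent_roots i j a b : i <> j -> a <> b ->
  ~~ ((1 \in S1 i j) && (1 \in S1 j i)) ->
  tangent a i != 0 -> tangent b j != 0 -> {subset S2 a b <= S1 i j}.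
Proof.
move=> ij ab Sij ai bj rho rhoS; have ji : j <> i by move/esym.
have disj c : phi c (f (x1 i)) = 0 \/ phi c (f (x1 j)) = 0.
  have /eqP : phi c (f (x1 i)) * phi c (f (x1 j)) = 0.
    move: Sij; rewrite negb_and => /orP[?|?]; first exact: axis_mapM_eq0.
    by rewrite mulrC; apply: axis_mapM_eq0.
  by rewrite mulf_eq0 => /orP[/eqP|/eqP]; [left|right].
have pj : phi (Some a) (f (x1 j)) = 0.
  case: (disj (Some a)) => // pi0; move: ai.
  by rewrite /tangent /lin_coef pi0 coef0 eqxx.
have pi0 : phi (Some b) (f (x1 i)) = 0.
  case: (disj (Some b)) => // pj0; move: bj.
  by rewrite /tangent /lin_coef pj0 coef0 eqxx.
have [pi piE] := exists_plane_map S2roots pA2 ab rhoS.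
have piP := plane_map_coefs S2roots pA2 ab piE.
have := congr1 (pi \o f) (presented_rel pA1 ij).
rewrite /= !rmorph_skew_serre !rmorph0.
have [jfst jsnd] := piP (f (x1 j)); have [ifst _] := piP (f (x1 i)).
move: jfst jsnd; rewrite pj; case: (pi (f (x1 j))) => p g /= -> g0.
rewrite skew_serre_sandwich ifst => -[/eqP]; rewrite mulf_eq0 => /orP[/eqP g_eq0|/eqP].
  by move: bj; rewrite /tangent -g0 g_eq0 coef0 eqxx.
move/dilate_sum_eq0 => H; rewrite -root_roots_poly /root horner_roots_poly.
apply/eqP/H => //.
by rewrite (axis_map_coef0 S2roots pA2) -(axis_map_coef0 S2roots pA2 (Some b)) pi0 coef0.
Qed.

End IsoRoots.

Section TangentRank.
Variables (K : fieldType) (I1 : Type) (I2 : finType).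
Variables (S1 : I1 -> I1 -> seq K) (S2 : I2 -> I2 -> seq K).
Variables (A1 A2 : algType K) (x1 : I1 -> A1) (x2 : I2 -> A2).
Hypothesis (S2roots : serre_roots S2).
Hypotheses (pA1 : serre_presented S1 x1) (pA2 : serre_presented S2 x2).
Variable f : {lrmorphism A1 -> A2}.

(** A linear combination of the derivations that kills all the f(x_i) kills the
    image of f, hence every generator of A2. *)
Lemma tangent_free : bijective f -> forall v : I2 -> K,
  (forall i, \sum_a v a * lin_coef S2roots pA2 a (f (x1 i)) = 0) ->
  forall a, v a = 0.
Proof.
move=> [f' _ fK] v vx a.
have H u : \sum_a v a * lin_coef S2roots pA2 a (f u) = 0.
  apply: (presented_ind pA1 (P := fun u =>
    \sum_a v a * lin_coef S2roots pA2 a (f u) = 0)) => [|k u1 u2 H1 H2|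
    u1 u2 H1 H2|//].
  - by rewrite rmorph1; apply: big1 => b _; rewrite lin_coef1 mulr0.
  - rewrite linearD linearZ /=.
    transitivity (k * \sum_b v b * lin_coef S2roots pA2 b (f u1)
                  + \sum_b v b * lin_coef S2roots pA2 b (f u2)).
      rewrite mulr_sumr -big_split; apply: eq_bigr => b _ /=.
      rewrite lin_coefD lin_coefZ; ring.
    by rewrite H1 H2 mulr0 addr0.
  - rewrite rmorphM.
    transitivity (augmentation S2roots pA2 (f u1)
                    * (\sum_b v b * lin_coef S2roots pA2 b (f u2))
                  + augmentation S2roots pA2 (f u2)
                    * \sum_b v b * lin_coef S2roots pA2 b (f u1)).
      rewrite !mulr_sumr -big_split; apply: eq_bigr => b _ /=.
      rewrite lin_coefM; ring.
    by rewrite H1 H2 !mulr0 addr0.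
have := H (f' (x2 a)); rewrite fK (bigD1 a) //= lin_coef_gen eqxx mulr1 big1 ?addr0 //.
by move=> b ba; rewrite lin_coef_gen eq_sym (negbTE ba) mulr0.
Qed.

End TangentRank.

(** * Matching the sets of roots *)

Section Transversal.
Variables (K : fieldType) (I1 I2 : finType) (M : I2 -> I1 -> K).
Hypothesis Mfree : forall v : I2 -> K,
  (forall i, \sum_a v a * M a i = 0) -> forall a, v a = 0.

Lemma free_rows_card : (#|I2| <= #|I1|)%N.
Proof.
pose N := \matrix_(k < #|I2|, l < #|I1|) M (enum_val k) (enum_val l).
suff /eqP <- : row_free N by exact: rank_leq_col.
rewrite -kermx_eq0; apply/eqP/row_matrixP => k; rewrite row0.
have : row k (kermx N) *m N = 0 by rewrite -row_mul mulmx_ker row0.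
move: (row k _) => u uN; apply/rowP => l; rewrite mxE.
have := Mfree (v := fun a => u 0 (enum_rank a)).
move/(_ _ (enum_val l)); rewrite enum_valK; apply=> i.
have /rowP/(_ (enum_rank i)) := uN; rewrite !mxE => E; rewrite -[RHS]E.
rewrite (reindex_onto enum_val enum_rank) /=; last by move=> a _; rewrite enum_rankK.
rewrite (eq_bigl predT) => [|a]; last by rewrite enum_valK eqxx.
by apply: eq_bigr => a _; rewrite enum_valK mxE enum_rankK.
Qed.

(** A nonzero determinant has a nonzero term in its Leibniz expansion. *)
Lemma exists_transversal : #|I1| = #|I2| ->
  exists2 theta : I1 -> I2, bijective theta & forall i, M (theta i) i != 0.
Proof.
move=> I12; pose h k := enum_val (cast_ord I12 k).
pose h' a := cast_ord (esym I12) (enum_rank a).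
have hK : cancel h h' by move=> k; rewrite /h /h' enum_valK cast_ordK.
have h'K : cancel h' h by move=> k; rewrite /h /h' cast_ordKV enum_rankK.
pose N := \matrix_(k < #|I1|, l < #|I1|) M (h k) (enum_val l).
have detN : \det N != 0.
  apply/det0P => -[u u0 uN]; case/eqP: u0; apply/rowP => l; rewrite mxE.
  have := Mfree (v := fun a => u 0 (h' a)).
  move/(_ _ (h l)); rewrite hK; apply=> i.
  have /rowP/(_ (enum_rank i)) := uN; rewrite !mxE => E; rewrite -[RHS]E.
  rewrite (reindex_onto h h') /=; last by move=> a _; rewrite h'K.
  rewrite (eq_bigl predT) => [|a]; last by rewrite hK eqxx.
  by apply: eq_bigr => a _; rewrite hK mxE enum_rankK.
have [s /prodf_neq0 sN] : exists s : {perm 'I_#|I1|}, \prod_k N k (s k) != 0.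
  apply/existsP; apply: contraNT detN => /existsPn H.
  by apply/eqP/big1 => s _; have /negPn/eqP -> := H s; rewrite mulr0.
exists (fun i => h ((s^-1)%g (enum_rank i))) => [|i].
  exists (fun a => enum_val (s (h' a))) => i.
    by rewrite hK permKV enum_rankK.
  by rewrite enum_valK permK h'K.
have := sN ((s^-1)%g (enum_rank i)) isT.
by rewrite mxE permKV enum_rankK.
Qed.

End Transversal.

Section MatchRoots.
Variable K : fieldType.

(** In the generic twisted algebras these are the pairs of generators that do not
    commute. *)
Definition noncommuting (I : finType) (S : I -> I -> seq K) : {set I * I} :=
  [set p | (p.1 != p.2) && ~~ ((1 \in S p.1 p.2) && (1 \in S p.2 p.1))].

Section OneWay.
Variables (I1 I2 : finType) (S1 : I1 -> I1 -> seq K) (S2 : I2 -> I2 -> seq K).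
Variable theta : I1 -> I2.
Hypotheses (theta_inj : injective theta) (thetaS : forall i j, i <> j ->
  ~~ ((1 \in S1 i j) && (1 \in S1 j i)) ->
  {subset S2 (theta i) (theta j) <= S1 i j}).
Hypothesis S2roots : serre_roots S2.

Local Notation theta2 := (fun p : I1 * I1 => (theta p.1, theta p.2)).

Lemma theta2_inj : injective theta2.
Proof. by move=> [i j] [k l] [/theta_inj -> /theta_inj ->]. Qed.

(** If the image pair had 1 among its roots in both orders, the inclusions would
    bring these back to (i, j). *)
Lemma theta_noncommuting p :
  p \in noncommuting S1 -> theta2 p \in noncommuting S2.
Proof.
case: p => i j; rewrite !inE /= => /andP[/eqP ij Sij].
apply/andP; split; first by apply/eqP => /theta_inj.
apply: contra (Sij) => /andP[H1 H2]; rewrite (thetaS ij Sij H1) /=.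
by apply: thetaS H2; [exact/nesym | rewrite andbC].
Qed.

Lemma noncommuting_card : (#|noncommuting S1| <= #|noncommuting S2|)%N.
Proof.
rewrite -(card_imset _ theta2_inj); apply/subset_leq_card/subsetP => r.
by move=> /imsetP[p pS ->]; apply: theta_noncommuting.
Qed.

Hypothesis le_card : (#|noncommuting S2| <= #|noncommuting S1|)%N.

Lemma theta_noncommutingE : theta2 @: noncommuting S1 = noncommuting S2.
Proof.
apply/eqP; rewrite eqEcard (card_imset _ theta2_inj) le_card andbT.
by apply/subsetP => _ /imsetP[p pS ->]; apply: theta_noncommuting.
Qed.

Lemma size_theta p : p \in noncommuting S1 ->
  (size (S2 (theta p.1) (theta p.2)) <= size (S1 p.1 p.2))%N.
Proof.
rewrite inE => /andP[/eqP ij Sij]; apply: uniq_leq_size; last exact: thetaS.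
by apply: (roots_uniq S2roots) => /theta_inj.
Qed.

Lemma sum_size_theta : \sum_(p in noncommuting S2) size (S2 p.1 p.2)
  = \sum_(p in noncommuting S1) size (S2 (theta p.1) (theta p.2)).
Proof.
by rewrite -theta_noncommutingE big_imset //= => p r _ _; apply: theta2_inj.
Qed.

Lemma sum_size_le : (\sum_(p in noncommuting S2) size (S2 p.1 p.2)
  <= \sum_(p in noncommuting S1) size (S1 p.1 p.2))%N.
Proof. by rewrite sum_size_theta; apply: leq_sum => p /size_theta. Qed.

Hypothesis le_sum : (\sum_(p in noncommuting S1) size (S1 p.1 p.2)
  <= \sum_(p in noncommuting S2) size (S2 p.1 p.2))%N.
Hypothesis S1roots : serre_roots S1.

(** The bounds [le_card] and [le_sum] come from the inverse isomorphism.  The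
    first makes the injection on noncommuting pairs a bijection; then the total
    number of roots, summed over these pairs, can only decrease along an
    inclusion and does not, so that every inclusion is an equality. *)
Lemma theta_rootsE i j : i <> j -> S2 (theta i) (theta j) =i S1 i j.
Proof.
move=> ij; have tij : theta i <> theta j by move/theta_inj.
have [nc|nc] := boolP ((i, j) \in noncommuting S1); last first.
  have : (theta i, theta j) \notin noncommuting S2.
    by rewrite -theta_noncommutingE (mem_imset _ (i, j) theta2_inj).
  move: nc; rewrite !inE /= ![~~ (_ && ~~ _)]negb_and !negbK.
  move: (ij) (tij) => /eqP/negbTE -> /eqP/negbTE -> /= /andP[a b] /andP[c d].
  by rewrite (roots_one S1roots ij a b) (roots_one S2roots tij c d).
have le_ij := fun p (pS : p \in noncommuting S1) => leqif_geq (size_theta pS).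
have [_] := leqif_sum le_ij; rewrite -sum_size_theta eqn_leq le_sum sum_size_le.
move=> /esym/forall_inP/(_ _ nc) /= le.
move: nc; rewrite inE => /andP[_ /= Sij].
have [|_ H] := uniq_min_size _ (thetaS ij Sij) le; first exact: (roots_uniq S2roots).
by move=> z; rewrite H.
Qed.

End OneWay.

Variables (I1 I2 : finType) (S1 : I1 -> I1 -> seq K) (S2 : I2 -> I2 -> seq K).
Variables (A1 A2 : algType K) (x1 : I1 -> A1) (x2 : I2 -> A2).
Hypotheses (S1roots : serre_roots S1) (S2roots : serre_roots S2).
Hypotheses (pA1 : serre_presented S1 x1) (pA2 : serre_presented S2 x2).

Theorem alg_iso_roots : alg_isomorphic A1 A2 ->
  exists2 theta : I1 -> I2, bijective theta &
    forall i j, i <> j -> S2 (theta i) (theta j) =i S1 i j.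
Proof.
move=> [f bf]; have [g fK gK] := bf.
have [f' f'E] : exists f' : {lrmorphism A2 -> A1}, f' =1 g.
  have gL : linear g.
    move=> k u v; apply: (can_inj fK).
    by rewrite linearD linearZ /= !gK.
  have gM : monoid_morphism g.
    split=> [|u v]; apply: (can_inj fK); rewrite gK ?rmorph1 //.
    by rewrite rmorphM /= !gK.
  pose gl := GRing.isLinear.Build K A2 A1 *:%R g gL.
  pose gm := GRing.isMonoidMorphism.Build A2 A1 g gM.
  pose G : {lrmorphism A2 -> A1} := HB.pack g gl gm.
  by exists G.
have bf' : bijective f' by exists f => u; rewrite f'E.
have free12 := tangent_free (S2roots := S2roots) (pA2 := pA2) pA1 bf.
have free21 := tangent_free (S2roots := S1roots) (pA2 := pA1) pA2 bf'.
have cardI : #|I1| = #|I2|.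
  by apply/eqP; rewrite eqn_leq (free_rows_card free12) (free_rows_card free21).
have [t12 b12 M12] := exists_transversal free12 cardI.
have [t21 b21 M21] := exists_transversal free21 (esym cardI).
have i12 := bij_inj b12; have i21 := bij_inj b21.
have sub12 i j : i <> j -> ~~ ((1 \in S1 i j) && (1 \in S1 j i)) ->
    {subset S2 (t12 i) (t12 j) <= S1 i j}.
  move=> ij Sij; apply: (tangent_roots (S2roots := S2roots) pA1 (pA2 := pA2) (f := f) ij) => //; try exact: M12.
  by move/i12.
have sub21 i j : i <> j -> ~~ ((1 \in S2 i j) && (1 \in S2 j i)) ->
    {subset S1 (t21 i) (t21 j) <= S2 i j}.
  move=> ij Sij; apply: (tangent_roots (S2roots := S1roots) pA2 (pA2 := pA1) (f := f') ij) => //; try exact: M21.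
  by move/i21.
have c12 := noncommuting_card i12 sub12; have c21 := noncommuting_card i21 sub21.
exists t12 => // i j ij.
exact: (theta_rootsE i12 sub12 S2roots c21 (sum_size_le i21 sub21 S1roots c12)).
Qed.

End MatchRoots.

(** * Presentation of the twisted algebras *)

Section QuantumBinomial.
Variables (K : fieldType) (t : K).
Hypotheses (t0 : t != 0) (tN1 : forall n, (0 < n)%N -> t ^+ n != 1).

(** The list of the r t^(m-1-2l), l < m, arranged so that the q-Pascal rule
    becomes an induction on m that replaces r by r / t. *)
Fixpoint qroots (r : K) (m : nat) : seq K :=
  if m is m'.+1 then r * t ^+ m' :: qroots (r / t) m' else [::].

Lemma size_qroots r m : size (qroots r m) = m.
Proof. by elim: m r => //= m IH r; rewrite IH. Qed.

Lemma expr_sub_inv_neq0 n : (0 < n)%N -> t ^+ n - t ^- n != 0.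
Proof.
move=> n0; rewrite subr_eq0; apply: contra_neq (tN1 (n := n + n) _);
  last by rewrite addn_gt0 n0.
by move=> e; rewrite exprD {2}e mulfV // expf_neq0.
Qed.

Lemma qint_neq0 n : (0 < n)%N -> qint t n != 0.
Proof.
move=> n0; rewrite mulf_neq0 ?invr_eq0 ?expr_sub_inv_neq0 //.
by have := expr_sub_inv_neq0 (isT : 0 < 1)%N; rewrite !expr1.
Qed.

Lemma qfactS n : qfact t n.+1 = qfact t n * qint t n.+1.
Proof. by rewrite /qfact big_nat_recr. Qed.

Lemma qfact0 : qfact t 0 = 1.
Proof. by rewrite /qfact big_geq. Qed.

Lemma qfact_neq0 n : qfact t n != 0.
Proof.
by elim: n => [|n IH]; rewrite ?qfact0 ?oner_eq0 // qfactS mulf_neq0 ?qint_neq0.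
Qed.

Lemma qbin0 m : qbin t m 0 = 1.
Proof. by rewrite /qbin qfact0 subn0 mul1r mulfV // qfact_neq0. Qed.

Lemma qbinn m : qbin t m m = 1.
Proof. by rewrite /qbin subnn qfact0 mulr1 mulfV // qfact_neq0. Qed.

Lemma qintD a b : qint t (a + b) = t ^+ a * qint t b + t ^- b * qint t a.
Proof.
have ta n : t ^+ n != 0 by rewrite expf_neq0.
rewrite /qint !mulrA -mulrDl; congr (_ / _); rewrite exprD.
by field; rewrite !ta.
Qed.

Lemma qbin_pascal a b :
  qbin t (a.+1 + b.+1) a.+1
    = t ^+ a.+1 * qbin t (a + b.+1) a.+1 + t ^- b.+1 * qbin t (a + b.+1) a.
Proof.
have fn0 := qfact_neq0; have in0 n := qint_neq0 (isT : 0 < n.+1)%N.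
rewrite /qbin; have -> : (a.+1 + b.+1 - a.+1)%N = b.+1 by lia.
have -> : (a + b.+1 - a.+1)%N = b by lia.
have -> : (a + b.+1 - a)%N = b.+1 by lia.
rewrite [in LHS]addSn !qfactS -[(a + b.+1).+1]addSn qintD.
by field; rewrite ?fn0 ?in0 ?t0 ?expf_neq0.
Qed.

(** The q-binomial theorem: the polynomial with these roots has the q-binomial
    coefficients of the Serre relations. *)
Lemma coef_qroots r m k : (k <= m)%N ->
  (roots_poly (qroots r m))`_k = (-1) ^+ (m - k) * r ^+ (m - k) * qbin t m k.
Proof.
elim: m r k => [|m IH] r k km.
  move: km; rewrite leqn0 => /eqP ->.
  by rewrite /roots_poly big_nil coef1 subnn !expr0 qbin0 !mulr1.
rewrite /roots_poly /= big_cons -/(roots_poly _) mulrBl coefB coefXM coefCM.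
case: k km => [|a].
  rewrite IH // !subn0 !qbin0 sub0r expr_div_n !exprS => _.
  by field; rewrite expf_neq0.
rewrite ltnS => am; rewrite IH //.
have [mE|ma] := leqP m a.
  have -> : m = a by apply/eqP; rewrite eqn_leq am mE.
  rewrite !subnn !expr0 !qbinn nth_default ?mulr0 ?subr0 //.
  by rewrite size_roots_poly size_qroots.
rewrite IH //= subSS; have [b bE] : exists b, m = (a + b.+1)%N.
  by exists (m - a.+1)%N; lia.
rewrite {am ma IH}bE; have -> : (a + b.+1 - a.+1)%N = b by lia.
have -> : (a + b.+1 - a)%N = b.+1 by lia.
rewrite -[(a + b.+1).+1]addSn qbin_pascal !expr_div_n !exprS exprD !exprS.
by field; rewrite t0 expf_neq0.
Qed.

Lemma qroots_neq0 r m : r != 0 -> 0 \notin qroots r m.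
Proof.
elim: m r => [//|m IH] r r0 /=; rewrite inE negb_or IH ?mulf_neq0 ?invr_neq0 //.
by rewrite eq_sym mulf_neq0 ?expf_neq0.
Qed.

Lemma mem_qroots r m z : z \in qroots r m ->
  exists2 l, (l < m)%N & z * t ^+ (l + l).+1 = r * t ^+ m.
Proof.
elim: m r => [//|m IH] r /=; rewrite inE => /orP[/eqP ->|/IH[l lm zE]].
  by exists 0%N; rewrite // addn0 expr1 exprSr mulrA.
exists l.+1 => //; have -> : (l.+1 + l.+1).+1 = ((l + l).+1 + 2)%N by lia.
by rewrite exprD mulrA zE expr2 exprSr; field.
Qed.

Lemma qroots_uniq r m : r != 0 -> uniq (qroots r m).
Proof.
elim: m r => [//|m IH] r r0 /=; rewrite IH ?mulf_neq0 ?invr_neq0 // andbT.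
apply/negP => /mem_qroots[l lm E]; suff : t ^+ (l + l).+2 == 1.
  by rewrite (negbTE (tN1 _)).
apply/eqP/(mulfI (mulf_neq0 r0 (expf_neq0 m t0))).
by rewrite exprSr mulrA E mulr1; field.
Qed.

Lemma sum_qroots r m : \sum_(z <- qroots r m) z = r * qint t m.
Proof.
elim: m r => [|m IH] r /=; first by rewrite big_nil /qint expr0 invr1 subrr mul0r mulr0.
have tt : t * t - 1 != 0 by rewrite subr_eq0 -expr2 tN1.
by rewrite big_cons IH /qint exprS; field; rewrite t0 tt expf_neq0.
Qed.

End QuantumBinomial.

Section TwistedPresentation.
Variables (R : realType) (g : simpleLie R) (K : fieldType) (q : K).
Variables (s : bool) (p : cocycle (lattice (Pi g)) K).
Hypothesis qrootN1 :
  forall (i : Pi g) n, (0 < n)%N -> qroot q i ^+ n != 1 :> K.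
Hypothesis qroot_neq0 : forall i : Pi g, qroot q i != 0 :> K.

Local Notation A := (Uqp q s p).
Local Notation wt := (@wt R g s).
Local Notation F := (freeAlg K (Pi g)).
Local Notation pi := (qpi (serre_ideal g q)).

Definition twist_gen (i : Pi g) : A := pi (fgen K i).

Definition twist_roots (i j : Pi g) : seq K :=
  qroots (qroot q i) (cocycle_r p (wt i) (wt j)) (serre_deg i j).

(** The scalar by which the twisted product of the generators along a word
    differs from their product in the untwisted algebra; the twisted unit
    accounts for the value on the empty word. *)
Fixpoint word_scalar (w : seq (Pi g)) : K :=
  if w is i :: w' then p (wt i) (word_wt wt w') * word_scalar w'
  else (p 0 0)^-1.

Lemma word_scalar_neq0 w : word_scalar w != 0.
Proof.
elim: w => [|i w IH] /=; first by rewrite invr_neq0 // cocycle_neq0.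
by rewrite mulf_neq0 // cocycle_neq0.
Qed.

Lemma word_wt_cons i w : word_wt wt (i :: w) = wt i + word_wt wt w.
Proof. exact: big_cons. Qed.

Lemma word_scalar_cat v w :
  word_scalar (v ++ w)
    = p (word_wt wt v) (word_wt wt w) * (word_scalar v * word_scalar w).
Proof.
elim: v => [|i v IH] /=.
  by rewrite word_wt_nil cocycle0l mulrA mulfV ?mul1r // cocycle_neq0.
rewrite IH word_wt_cat word_wt_cons.
have := cocycleP p (wt i) (word_wt wt v) (word_wt wt w).
set a := p _ _; set b := p _ _; set c := p _ _; set d := p _ _ => E.
by transitivity (c * d * (word_scalar v * word_scalar w)); [|rewrite -E]; ring.
Qed.

(** Only r, and not the cocycle itself, is seen when the letters of a word are
    permuted: the weights of the other letters cancel by the cocycle identity. *)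
Lemma word_scalar_swap u i j v :
  word_scalar (u ++ i :: j :: v)
    = cocycle_r p (wt i) (wt j) * word_scalar (u ++ j :: i :: v).
Proof.
have H a b : word_scalar (a :: b :: v)
    = p (wt a) (wt b) * (p (wt a + wt b) (word_wt wt v) * word_scalar v).
  rewrite /= word_wt_cons mulrA [RHS]mulrA cocycleP; ring.
rewrite !word_scalar_cat !H !word_wt_cons !addrA [wt j + wt i]addrC.
by rewrite /cocycle_r; field; rewrite cocycle_neq0.
Qed.

Lemma word_scalar_power i j k l :
  word_scalar (nseq k i ++ j :: nseq l i)
    = cocycle_r p (wt i) (wt j) ^+ k * word_scalar (j :: nseq (k + l) i).
Proof.
elim: k l => [|k IH] l; first by rewrite expr0 mul1r.
rewrite -[k.+1]addn1 nseqD -catA /= word_scalar_swap -[i :: nseq l i]/(nseq l.+1 i).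
by rewrite IH addnS addn1 exprS mulrA.
Qed.

Lemma twist_genM (x y : F) :
  (pi x : A) * (pi y : A) = pi (free_twist wt p x y) :> A.
Proof. by rewrite qpi_twist. Qed.

Lemma twist_gen_word w :
  \prod_(i <- w) twist_gen i = word_scalar w *: (pi (mono K w) : A).
Proof.
elim: w => [|i w IH].
  by rewrite big_nil mono1 rmorph1.
rewrite big_cons IH -[LHS]scalerAr twist_genM.
have -> : free_twist wt p (fgen K i) (mono K w)
    = p (wt i) (word_wt wt w) *: mono K (i :: w).
  rewrite -[fgen K i]scale1r -[mono K w]scale1r free_twist_mono /word_wt big_seq1.
  by rewrite !mulr1.
have -> : (pi (p (wt i) (word_wt wt w) *: mono K (i :: w)) : A)
    = p (wt i) (word_wt wt w) *: (pi (mono K (i :: w)) : A) by exact: qpiZ.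
by rewrite scalerA [word_scalar _ * _]mulrC.
Qed.

Lemma twist_serre_word i j k l :
  twist_gen i ^+ k * twist_gen j * twist_gen i ^+ l
    = word_scalar (nseq k i ++ j :: nseq l i)
        *: (pi (fgen K i ^+ k * fgen K j * fgen K i ^+ l) : A).
Proof.
have E n : twist_gen i ^+ n = \prod_(a <- nseq n i) twist_gen a.
  by elim: n => [|n IH]; rewrite ?big_nil ?expr0 // exprS IH big_cons.
have E' n : fgen K i ^+ n = mono K (nseq n i).
  by elim: n => [|n IH]; rewrite ?expr0 ?mono1 // exprS IH monoM.
rewrite !E -[twist_gen j](big_seq1 *%R j) -!big_cat /= twist_gen_word -catA /=.
by rewrite !E' !monoM -catA.
Qed.

Lemma sign_shift (r c b : K) k m : (k <= m)%N -> r != 0 -> c != 0 ->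
  (-1) ^+ (m - k) * r ^+ (m - k) * b
    = (- r) ^+ m * c * ((-1) ^+ k * b) / (r ^+ k * c).
Proof.
move=> km r0 c0; rewrite [(- r) ^+ m]exprNn -{3 4}(subnK km) !exprD.
have sgn : (-1) ^+ k * (-1) ^+ k = 1 :> K by rewrite -exprMn mulrNN mulr1 expr1n.
transitivity ((-1) ^+ (m - k) * ((-1) ^+ k * (-1) ^+ k) * r ^+ (m - k) * b).
  by rewrite sgn mulr1.
by field; rewrite c0 expf_neq0.
Qed.

(** By [word_scalar_power] the scalar of the word i^k j i^(m-k) is r^k times a
    constant, which is absorbed by scaling the roots by r.  The statement is for
    an arbitrary family [b]: it yields the relations in the twisted algebra as
    well as the fact that a map defined by them kills the Serre element. *)
Lemma skew_serre_twist (B : algType K) (b : Pi g -> B) i j :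
  let m := serre_deg i j in
  skew_serre (twist_roots i j) (b i) (b j) =
  ((- cocycle_r p (wt i) (wt j)) ^+ m * word_scalar (j :: nseq m i)) *:
    \sum_(k < m.+1) ((-1) ^+ k * qbin (qroot q i) m k) *:
       ((word_scalar (nseq k i ++ j :: nseq (m - k) i))^-1 *:
          (b i ^+ k * b j * b i ^+ (m - k))).
Proof.
move=> m; rewrite /skew_serre size_qroots -/m scaler_sumr.
apply: eq_bigr => k _; have km : (k <= m)%N by rewrite -ltnS.
rewrite !scalerA word_scalar_power subnKC // (coef_qroots (qroot_neq0 i) (@qrootN1 i)) //; congr (_ *: _).
apply: sign_shift km _ (word_scalar_neq0 _).
by rewrite mulf_neq0 ?invr_neq0 // cocycle_neq0.
Qed.

Lemma twist_gen_serre : serre_tuple twist_roots twist_gen.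
Proof.
move=> i j ij; rewrite skew_serre_twist; set c := _ * _.
rewrite [X in c *: X](_ : _ = (pi (serre q i j) : A)).
  suff -> : (pi (serre q i j) : A) = 0 by rewrite scaler0.
  apply/qpiP; rewrite subr0 -[serre q i j]mul1r -[1 * _]mulr1; apply: ideal_gen_in.
  by exists i, j; split=> //; apply/eqP.
rewrite /serre [RHS](linear_sum pi); apply: eq_bigr => k _.
rewrite [RHS]qpiZ; congr (_ *: _).
by rewrite twist_serre_word scalerA mulVf ?scale1r // word_scalar_neq0.
Qed.

Section Lift.
Variables (B : algType K) (b : Pi g -> B).
Hypothesis bS : serre_tuple twist_roots b.

Definition word_lift (x : F) : B :=
  free_lin (fun w => (word_scalar w)^-1 *: \prod_(i <- w) b i) x.

Lemma word_liftD x y : word_lift (x + y) = word_lift x + word_lift y.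
Proof. exact: linearD. Qed.
Lemma word_liftZ a x : word_lift (a *: x) = a *: word_lift x.
Proof. exact: linearZZ. Qed.
Lemma word_lift0 : word_lift 0 = 0.
Proof. exact: linear0. Qed.
Lemma word_lift_mono w :
  word_lift (mono K w) = (word_scalar w)^-1 *: \prod_(i <- w) b i.
Proof. exact: free_lin_mono. Qed.

Lemma word_liftM x y : word_lift (free_twist wt p x y) = word_lift x * word_lift y.
Proof.
elim/free_ind: x => [|x1 x2 IH1 IH2|a v].
- by rewrite free_twist0l word_lift0 mul0r.
- by rewrite free_twistDl !word_liftD IH1 IH2 mulrDl.
elim/free_ind: y => [|y1 y2 IH1 IH2|c w].
- by rewrite free_twist0r word_lift0 mulr0.
- by rewrite free_twistDr !word_liftD IH1 IH2 mulrDr.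
rewrite free_twist_mono !word_liftZ !word_lift_mono word_scalar_cat big_cat /=.
rewrite -!scalerAl -!scalerAr !scalerA; congr (_ *: _).
by field; rewrite cocycle_neq0 !word_scalar_neq0.
Qed.

Lemma word_lift_serre i j : i != j -> word_lift (serre q i j) = 0.
Proof.
move=> /eqP ij; have /eqP := bS ij; rewrite skew_serre_twist scaler_eq0 => /orP[|/eqP <-].
  rewrite mulf_eq0 expf_eq0 oppr_eq0 (negbTE (word_scalar_neq0 _)) orbF.
  by rewrite mulf_eq0 invr_eq0 !(negbTE (cocycle_neq0 _ _ _)) andbF.
rewrite /serre (big_morph _ word_liftD word_lift0); apply: eq_bigr => k _.
rewrite word_liftZ; congr (_ *: _).
have E n : fgen K i ^+ n = mono K (nseq n i).
  by elim: n => [|n IH]; rewrite ?expr0 ?mono1 // exprS IH monoM.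
have E' n : \prod_(a <- nseq n i) b a = b i ^+ n.
  by elim: n => [|n IH]; rewrite ?big_nil ?expr0 // exprS -IH big_cons.
by rewrite !E !monoM -catA word_lift_mono big_cat big_cons /= !E' mulrA.
Qed.

(** The ideal is generated by homogeneous elements, on which the two products
    are proportional, so multiplicativity for the twisted product suffices. *)
Lemma word_lift_ideal x : serre_ideal g q x -> word_lift x = 0.
Proof.
elim=> [|x1 x2 _ IH1 _ IH2|u y v [i [j [ij ->]]]].
  exact: word_lift0.
  by rewrite word_liftD IH1 IH2 addr0.
have [c hc] : exists c, homog wt c (serre q i j).
  by apply: (@serre_homog R g K q s); exists i, j.
elim/free_ind: u => [|u1 u2 IH1 IH2|a u]; first by rewrite !mul0r word_lift0.
  by rewrite !mulrDl word_liftD IH1 IH2 addr0.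
elim/free_ind: v => [|v1 v2 IH1 IH2|a' v]; first by rewrite !mulr0 word_lift0.
  by rewrite !mulrDr word_liftD IH1 IH2 addr0.
have hu : homog wt (word_wt wt u) (a *: mono K u) by apply/homogZ/homog_mono.
have hv : homog wt (word_wt wt v) (a' *: mono K v) by apply/homogZ/homog_mono.
have := free_twist_homog p (homogM hu hc) hv.
have := free_twist_homog p hu hc.
move=> /(congr1 word_lift) E1 /(congr1 word_lift) E2; move: E1 E2.
rewrite !word_liftM word_lift_serre // mulr0 !word_liftZ.
move=> /esym/eqP; rewrite scaler_eq0 (negbTE (cocycle_neq0 _ _ _)) /= => /eqP ->.
by rewrite mul0r => /esym/eqP; rewrite scaler_eq0 (negbTE (cocycle_neq0 _ _ _)) => /eqP.
Qed.

Lemma word_lift_repr x : word_lift (qrepr (pi x)) = word_lift x.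
Proof.
rewrite -[LHS](subrK (word_lift x)) -[X in _ - X + _]scale1r -scaleNr -word_liftZ.
by rewrite -word_liftD scaleN1r word_lift_ideal ?add0r //; apply: qrepr_pi.
Qed.

Definition twist_lift (u : A) : B := word_lift (qrepr (u : Uq g q)).

Lemma twist_liftE x : twist_lift (pi x) = word_lift x.
Proof. exact: word_lift_repr. Qed.

Lemma twist_lift_gen i : twist_lift (twist_gen i) = b i.
Proof.
rewrite twist_liftE word_lift_mono big_seq1 /= word_wt_nil cocycle0r.
by rewrite mulfV ?invr1 ?scale1r // cocycle_neq0.
Qed.

Lemma twist_lift_linear : linear twist_lift.
Proof.
move=> a u v; rewrite -[u](qreprK (u : Uq g q)) -[v](qreprK (v : Uq g q)).
have -> : a *: (pi (qrepr (u : Uq g q)) : A) + (pi (qrepr (v : Uq g q)) : A)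
   = pi (a *: qrepr (u : Uq g q) + qrepr (v : Uq g q)) :> A by rewrite qpiD qpiZ.
by rewrite !twist_liftE word_liftD word_liftZ.
Qed.

Lemma twist_lift_monoid : monoid_morphism twist_lift.
Proof.
split=> [|u v].
  have -> : (1 : A) = pi (@free_twist1 K (Pi g) _ p) :> A by rewrite /free_twist1 qpiZ.
  rewrite twist_liftE /free_twist1 -mono1 word_liftZ word_lift_mono /=.
  by rewrite big_nil invrK scalerA mulVf ?scale1r // cocycle_neq0.
rewrite -[u](qreprK (u : Uq g q)) -[v](qreprK (v : Uq g q)).
by rewrite twist_genM !twist_liftE word_liftM.
Qed.

Lemma exists_twist_lift : exists f : {lrmorphism A -> B}, forall i, f (twist_gen i) = b i.
Proof.
pose fl := GRing.isLinear.Build K A B *:%R twist_lift twist_lift_linear.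
pose fm := GRing.isMonoidMorphism.Build A B twist_lift twist_lift_monoid.
pose f : {lrmorphism A -> B} := HB.pack twist_lift fl fm.
by exists f => i; apply: twist_lift_gen.
Qed.

End Lift.

Lemma twist_presented : serre_presented twist_roots twist_gen.
Proof.
split; [exact: twist_gen_serre | exact: exists_twist_lift |].
move=> P P1 PD PM Px u; rewrite -[u](qreprK (u : Uq g q)).
have P0 : P 0 by have := PD (-1) 1 1 P1 P1; rewrite scaleN1r addNr.
have PZ a v : P v -> P (a *: v) by move=> Pv; rewrite -[_ *: _]addr0; apply: PD.
elim/free_ind: (qrepr _) => [|x y IHx IHy|a w]; first by rewrite rmorph0.
  by have := PD 1 _ _ IHx IHy; rewrite scale1r -[X in P X -> _](qpiD _ x y).
rewrite qpiZ; apply: (PZ a); rewrite -[pi _](scalerK (word_scalar_neq0 w)).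
have := PZ (word_scalar w)^-1; apply; rewrite -[X in P X]twist_gen_word.
by elim: w => [|i w IH]; rewrite ?big_nil // big_cons; apply: PM.
Qed.

End TwistedPresentation.

(** * Triangular decomposition in a Lie algebra *)

Definition subspace (C : fieldType) (V : lmodType C) (P : V -> Prop) : Prop :=
  P 0 /\ forall a x y, P x -> P y -> P (a *: x + y).

Section Subspace.
Variables (C : fieldType) (V : lmodType C) (P : V -> Prop).
Hypothesis sP : subspace P.

Lemma subspace0 : P 0. Proof. by case: sP. Qed.
Lemma subspaceP a x y : P x -> P y -> P (a *: x + y).
Proof. by case: sP => _; apply. Qed.
Lemma subspaceD x y : P x -> P y -> P (x + y).
Proof. by move=> Px Py; rewrite -[x]scale1r; apply: subspaceP. Qed.
Lemma subspaceZ a x : P x -> P (a *: x).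
Proof. by move=> Px; rewrite -[_ *: _]addr0; apply: subspaceP => //; apply: subspace0. Qed.
Lemma subspaceN x : P x -> P (- x).
Proof. by rewrite -scaleN1r; apply: subspaceZ. Qed.
Lemma subspace_sum (I : Type) (r : seq I) (Q : pred I) (f : I -> V) :
  (forall i, Q i -> P (f i)) -> P (\sum_(i <- r | Q i) f i).
Proof. by move=> H; apply: big_ind => //; [exact: subspace0 | exact: subspaceD]. Qed.

End Subspace.

(** Take a subspace of maximal dimension among those contained in P.  This allows
    one to work with inductively defined subspaces. *)
Lemma subspace_vspace (C : fieldType) (V : vectType C) (P : V -> Prop) :
  subspace P -> exists U : {vspace V}, forall x, x \in U <-> P x.
Proof.
move=> sP.
pose Q n := `[< exists U : {vspace V}, \dim U = n /\ forall x, x \in U -> P x >].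
have exQ : exists n, Q n.
  exists 0%N; apply/asboolP; exists 0%VS; split=> [|x]; first exact: dimv0.
  by rewrite memv0 => /eqP ->; apply: subspace0.
have leQ n : Q n -> (n <= \dim {: V})%N.
  by move=> /asboolP[U [<- _]]; apply/dimvS/subvf.
case: (ex_maxnP exQ leQ) => n /asboolP[U [dimU UP]] maxn; exists U => x; split; first exact: UP.
move=> Px; have UW := addvSl U <[x]>%VS.
suff /eqP -> : U == (U + <[x]>)%VS.
  by apply: (subvP (addvSr U _)); apply: memv_line.
rewrite eqEdim UW dimU; apply/maxn/asboolP; exists (U + <[x]>)%VS; split=> // y.
move=> /memv_addP[u uU [_ /vlineP[k ->] ->]]; rewrite addrC.
by apply: subspaceP => //; apply: UP.
Qed.

Section PositivePart.
Variables (C : numFieldType) (V : lmodType C).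

(** The product of the T - k for 1 <= k <= N. *)
Fixpoint kill (T : V -> V) (N : nat) (x : V) : V :=
  if N is n.+1 then T (kill T n x) - n.+1%:R *: kill T n x else x.

(** The sum of the generalised eigenspaces of T with positive integral
    eigenvalue, without reference to a decomposition into eigenvectors. *)
Definition positive_part (T : V -> V) (x : V) : Prop := exists N, kill T N x = 0.

Section OneMap.
Variable T : {linear V -> V}.

Lemma kill_linear N a x y : kill T N (a *: x + y) = a *: kill T N x + kill T N y.
Proof.
elim: N => //= n ->; rewrite linearD linearZ /= scalerDr opprD addrACA scalerBr.
by rewrite !scalerA mulrC.
Qed.

Lemma kill0 N : kill T N 0 = 0.
Proof. by elim: N => //= n ->; rewrite linear0 scaler0 subr0. Qed.

Lemma kill_le N M x : (N <= M)%N -> kill T N x = 0 -> kill T M x = 0.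
Proof.
move=> /subnK <-; elim: (M - N)%N => [//|n IH] /IH; rewrite addSn /= => ->.
by rewrite linear0 scaler0 subr0.
Qed.

Lemma subspace_positive : subspace (positive_part T).
Proof.
split=> [|a x y [N Nx] [M My]]; first by exists 0%N.
exists (maxn N M); rewrite kill_linear (kill_le (leq_maxl _ _) Nx).
by rewrite (kill_le (leq_maxr _ _) My) scaler0 addr0.
Qed.

Lemma kill_comm (U : {linear V -> V}) : (forall x, U (T x) = T (U x)) ->
  forall N x, U (kill T N x) = kill T N (U x).
Proof.
by move=> UT; elim=> //= n IH x; rewrite linearB linearZ /= UT IH.
Qed.

Lemma kill_ker N x : T x = 0 -> exists2 c, c != 0 & kill T N x = c *: x.
Proof.
move=> Tx; elim: N => [|n [c c0 IH]]; first by exists 1; rewrite ?scale1r ?oner_neq0.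
exists (- n.+1%:R * c); first by rewrite mulf_neq0 // oppr_eq0 pnatr_eq0.
by rewrite /= IH linearZ /= Tx scaler0 add0r scalerA mulNr scaleNr.
Qed.

(** U raises eigenvalues of T by 1. *)
Lemma positive_shift (U : {linear V -> V}) : (forall x, T (U x) = U (T x) + U x) ->
  forall x, positive_part T x -> positive_part T (U x).
Proof.
move=> TU x [N Nx]; exists N.+1.
suff -> : kill T N.+1 (U x) = U (T (kill T N x)) by rewrite Nx !linear0.
elim: N {Nx} => [|n IH].
  by rewrite /= scale1r TU addrK.
have -> : kill T n.+2 (U x)
    = T (U (T (kill T n x))) - n.+2%:R *: U (T (kill T n x)) by rewrite -IH.
rewrite TU /= !linearB !linearZ /= -addrA; congr (_ + _).
by rewrite !scalerN -[n.+2%:R]natr1 scalerDl scale1r opprD addrCA subrr addr0.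
Qed.

Lemma eigen1_positive x : T x = x -> positive_part T x.
Proof. by move=> Tx; exists 1%N; rewrite /= Tx scale1r subrr. Qed.

Lemma positive_ker0 x : T x = 0 -> positive_part T x -> x = 0.
Proof.
move=> /kill_ker H [N]; have [c c0 ->] := H N.
by move/eqP; rewrite scaler_eq0 (negbTE c0) => /eqP.
Qed.

End OneMap.

(** On the kernel of T the products that kill u and w act by nonzero scalars. *)
Lemma positive_negative_ker0 (T T' : {linear V -> V}) u w :
  (forall x, T' x = - T x) -> T (u + w) = 0 ->
  positive_part T u -> positive_part T' w -> u + w = 0.
Proof.
move=> T'E Tuw [N Nu] [M Mw].
have TT' x : T (T' x) = T' (T x) by rewrite !T'E linearN.
have kk x : kill T N (kill T' M x) = kill T' M (kill T N x).
  elim: N {Nu} => //= n ->; rewrite -/(kill T' M _).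
  rewrite (kill_comm (T := T')) //.
  by rewrite -scaleNr addrC -kill_linear addrC scaleNr.
have [c c0 cE] := kill_ker N Tuw.
have [d d0 dE] : exists2 d, d != 0 & kill T' M (u + w) = d *: (u + w).
  by apply: kill_ker; rewrite T'E Tuw oppr0.
have : kill T' M (kill T N (u + w)) = 0.
  rewrite -[u]scale1r kill_linear Nu scaler0 add0r -kk Mw; exact: kill0.
rewrite cE -[c *: _]addr0 kill_linear kill0 addr0 dE scalerA => /eqP.
by rewrite scaler_eq0 mulf_eq0 (negbTE c0) (negbTE d0) => /eqP.
Qed.

End PositivePart.

Section LieBasics.
Variables (C : numFieldType) (L : lieAlgebra C).
Implicit Types x y z : L.

Definition ad x : L -> L := bracket x.

HB.instance Definition _ x := GRing.isLinear.Build C L L *:%R (ad x) (bracket_linearr x).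

Lemma bracketDr x y z : bracket x (y + z) = bracket x y + bracket x z.
Proof. exact: (linearD (ad x)). Qed.
Lemma bracketZr a x y : bracket x (a *: y) = a *: bracket x y.
Proof. exact: (linearZZ (ad x)). Qed.
Lemma bracketNr x y : bracket x (- y) = - bracket x y.
Proof. exact: (linearN (ad x)). Qed.
Lemma bracket0r x : bracket x 0 = 0.
Proof. exact: (linear0 (ad x)). Qed.
Lemma bracketPl a x y z : bracket (a *: x + y) z = a *: bracket x z + bracket y z.
Proof. exact: bracket_linearl. Qed.
Lemma bracketDl x y z : bracket (x + y) z = bracket x z + bracket y z.
Proof. by rewrite -[x]scale1r bracketPl !scale1r. Qed.
Lemma bracket0l z : bracket 0 z = 0.
Proof. by have := bracketPl (-1) 0 0 z; rewrite scaler0 addr0 scaleN1r addNr. Qed.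
Lemma bracketZl a x z : bracket (a *: x) z = a *: bracket x z.
Proof. by rewrite -[_ *: x]addr0 bracketPl bracket0l addr0. Qed.
Lemma bracketNl x z : bracket (- x) z = - bracket x z.
Proof. by rewrite -scaleN1r bracketZl scaleN1r. Qed.

Lemma bracketC x y : bracket x y = - bracket y x.
Proof.
apply/eqP; rewrite -subr_eq0 opprK; apply/eqP.
have := bracket_alt (x + y).
by rewrite bracketDl !bracketDr !bracket_alt add0r addr0.
Qed.

Lemma bracket_leibniz x y z :
  bracket x (bracket y z) = bracket (bracket x y) z + bracket y (bracket x z).
Proof.
have /eqP := bracket_jacobi x y z; rewrite -addrA addr_eq0 => /eqP ->.
by rewrite opprD addrC -bracketC -bracketNr -bracketC.
Qed.

Lemma bracket_suml (I : Type) (r : seq I) (P : pred I) (f : I -> L) z :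
  bracket (\sum_(i <- r | P i) f i) z = \sum_(i <- r | P i) bracket (f i) z.
Proof.
elim/big_rec2: _ => [|i y x _ <-]; first exact: bracket0l.
exact: bracketDl.
Qed.

Inductive subalgebra (X : L -> Prop) : L -> Prop :=
  | subalgebra_gen x : X x -> subalgebra X x
  | subalgebra0 : subalgebra X 0
  | subalgebraP a x y : subalgebra X x -> subalgebra X y -> subalgebra X (a *: x + y)
  | subalgebra_bracket x y : subalgebra X x -> subalgebra X y ->
      subalgebra X (bracket x y).

Lemma subspace_subalgebra X : subspace (subalgebra X).
Proof. by split; [exact: subalgebra0 | exact: subalgebraP]. Qed.

Lemma normalizer_subalgebra (P : L -> Prop) X : subspace P ->
  (forall x, X x -> forall y, P y -> P (bracket x y)) ->
  forall x, subalgebra X x -> forall y, P y -> P (bracket x y).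
Proof.
move=> sP XP x; elim=> {x} [x /XP//|y Py|a x y _ IHx _ IHy z Pz|x y _ IHx _ IHy z Pz].
- by rewrite bracket0l; apply: subspace0.
- by rewrite bracketPl; apply: subspaceP => //; [apply: IHx | apply: IHy].
- have -> : bracket (bracket x y) z
      = bracket x (bracket y z) - bracket y (bracket x z).
    by rewrite bracket_leibniz addrK.
  apply: subspaceD => //; first exact/IHx/IHy.
  by apply: subspaceN => //; apply/IHy/IHx.
Qed.

(** With X the family E this is the nilpotent subalgebra generated by E, obtained
    from right nested brackets only. *)
Inductive ad_closure (I : Type) (E : I -> L) (X : L -> Prop) : L -> Prop :=
  | ad_closure_gen x : X x -> ad_closure E X x
  | ad_closure0 : ad_closure E X 0
  | ad_closureP a x y : ad_closure E X x -> ad_closure E X y ->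
      ad_closure E X (a *: x + y)
  | ad_closure_ad i x : ad_closure E X x -> ad_closure E X (bracket (E i) x).

Lemma subspace_ad_closure (I : Type) (E : I -> L) X : subspace (ad_closure E X).
Proof. by split; [exact: ad_closure0 | exact: ad_closureP]. Qed.

Lemma ad_closure_positive (I : Type) (E : I -> L) X rho :
  (forall i, bracket rho (E i) = E i) ->
  (forall x, X x -> positive_part (ad rho) x) ->
  forall x, ad_closure E X x -> positive_part (ad rho) x.
Proof.
move=> rhoE Xpos x; elim=> {x} [//||a x y _ IHx _ IHy|i x _ IH].
- exact: (subspace0 (subspace_positive _)).
- exact: (subspaceP (subspace_positive _)).
- apply: (positive_shift (U := ad (E i))) IH => y.
  by rewrite [LHS]bracket_leibniz rhoE addrC.
Qed.

Record chevalley (I : finType) (a : I -> I -> int) (E F : I -> L) : Prop :=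
  Chevalley {
  chevalley_ef : forall i j, i != j -> bracket (E i) (F j) = 0;
  chevalley_hh : forall i j, bracket (bracket (E i) (F i)) (bracket (E j) (F j)) = 0;
  chevalley_he : forall i j, bracket (bracket (E i) (F i)) (E j) = (a i j)%:~R *: E j;
  chevalley_hf : forall i j, bracket (bracket (E i) (F i)) (F j) = - (a i j)%:~R *: F j
}.

Lemma chevalley_swap (I : finType) (a : I -> I -> int) E F : chevalley a E F -> chevalley a F E.
Proof.
move=> ch; split=> [i j|i j|i j|i j].
- by rewrite eq_sym => /(chevalley_ef ch) H; rewrite bracketC H oppr0.
- rewrite [bracket (F i) _]bracketC [bracket (F j) _]bracketC bracketNl bracketNr.
  by rewrite (chevalley_hh ch) !oppr0.
- by rewrite [bracket (F i) _]bracketC bracketNl (chevalley_hf ch) scaleNr opprK.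
- by rewrite [bracket (F i) _]bracketC bracketNl (chevalley_he ch) scaleNr.
Qed.

Section Triangular.
Variables (I : finType) (a : I -> I -> int) (E F : I -> L).
Hypothesis ch : chevalley a E F.

Local Notation H i := (bracket (E i) (F i)).

Definition coroot_span (z : L) : Prop := exists c : I -> C, z = \sum_i c i *: H i.

Lemma subspace_coroot : subspace coroot_span.
Proof.
split=> [|k _ _ [c ->] [d ->]].
  by exists (fun _ => 0); rewrite big1 // => i _; rewrite scale0r.
exists (fun i => k * c i + d i); rewrite scaler_sumr -big_split.
by apply: eq_bigr => i _; rewrite scalerDl scalerA.
Qed.

Lemma coroot_in_span k : coroot_span (H k).
Proof.
exists (fun i => (i == k)%:R); rewrite (bigD1 k) //= eqxx scale1r big1 ?addr0 //.
by move=> i /negbTE ->; rewrite scale0r.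
Qed.

Lemma bracket_coroot_span z j : coroot_span z ->
  (exists c, bracket z (E j) = c *: E j) /\ (exists c, bracket z (F j) = c *: F j).
Proof.
move=> [c ->]; split.
  exists (\sum_i c i * (a i j)%:~R); rewrite bracket_suml scaler_suml.
  by apply: eq_bigr => i _; rewrite bracketZl (chevalley_he ch) scalerA.
exists (\sum_i c i * - (a i j)%:~R); rewrite bracket_suml scaler_suml.
by apply: eq_bigr => i _; rewrite bracketZl (chevalley_hf ch) scalerA.
Qed.

Lemma ad_closure_coroot X k :
  (forall x, X x -> ad_closure E X (bracket (H k) x)) ->
  forall x, ad_closure E X x -> ad_closure E X (bracket (H k) x).
Proof.
move=> XH x; elim=> {x} [//||b x y _ IHx _ IHy|i x Wx IH].
- by rewrite bracket0r; apply: ad_closure0.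
- by rewrite bracketDr bracketZr; apply: ad_closureP.
- rewrite bracket_leibniz (chevalley_he ch) bracketZl.
  by apply: ad_closureP; apply: ad_closure_ad.
Qed.

(** The commutation of ad (F k) past an ad (E i) only leaves an ad (H i), under
    which the closure is stable. *)
Lemma ad_closure_lower X (Q : L -> Prop) : subspace Q ->
  (forall x, ad_closure E X x -> Q x) ->
  (forall i x, Q x -> Q (bracket (E i) x)) ->
  (forall k x, X x -> ad_closure E X (bracket (H k) x)) ->
  (forall k x, X x -> Q (bracket (F k) x)) ->
  forall k x, ad_closure E X x -> Q (bracket (F k) x).
Proof.
move=> sQ WQ QE XH XF k x; elim=> {x} [x /XF//||b x y _ IHx _ IHy|i x Wx IH].
- by rewrite bracket0r; apply: subspace0.
- by rewrite bracketDr bracketZr; apply: subspaceP.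
rewrite bracket_leibniz; apply: subspaceD => //; last exact: QE.
have [<-|ki] := eqVneq i k; last first.
  by rewrite bracketC [bracket (F k) _]bracketC (chevalley_ef ch) // oppr0
    bracket0r oppr0; apply: subspace0.
rewrite [bracket (F i) _]bracketC bracketNl; apply: subspaceN => //.
by apply/WQ/ad_closure_coroot => // y; apply: XH.
Qed.

Definition nilpotent_part := ad_closure E (fun x => exists i, x = E i).

Lemma nilpotent_coroot k x : nilpotent_part x -> nilpotent_part (bracket (H k) x).
Proof.
apply: ad_closure_coroot => _ [i ->]; rewrite (chevalley_he ch) -[_ *: _]addr0.
by apply: ad_closureP; [apply: ad_closure_gen; exists i | apply: ad_closure0].
Qed.

Lemma borel_lower k x : nilpotent_part x ->
  exists u h, [/\ nilpotent_part u, coroot_span h & bracket (F k) x = u + h].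
Proof.
pose Q z := exists u h, [/\ nilpotent_part u, coroot_span h & z = u + h].
have sN : subspace nilpotent_part := subspace_ad_closure _ _.
have sH := subspace_coroot.
have sQ : subspace Q.
  split=> [|b _ _ [u [h [nu sh ->]]] [v [l [nv sl ->]]]].
    by exists 0, 0; rewrite addr0; split=> //; apply: subspace0.
  exists (b *: u + v), (b *: h + l); split; [exact: subspaceP..|].
  by rewrite scalerDr addrACA.
have QH h : coroot_span h -> Q h.
  by exists 0, h; rewrite add0r; split=> //; apply: subspace0.
have QN u : nilpotent_part u -> Q u.
  by exists u, 0; rewrite addr0; split=> //; apply: subspace0.
have genE i : nilpotent_part (E i) by apply: ad_closure_gen; exists i.
apply: (ad_closure_lower (Q := Q)) => //.
- move=> i _ [u [h [nu /(bracket_coroot_span i)[[c hE] _] ->]]]; apply: QN.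
  rewrite bracketDr [bracket _ h]bracketC hE; apply: subspaceD => //.
    exact: ad_closure_ad.
  exact: (subspaceN sN (subspaceZ sN c (genE i))).
- by move=> l _ [i ->]; apply: nilpotent_coroot.
move=> l _ [i ->]; rewrite bracketC; have [->|il] := eqVneq i l.
  exact/QH/(subspaceN sH)/coroot_in_span.
by rewrite (chevalley_ef ch) // oppr0; apply: (subspace0 sQ).
Qed.

End Triangular.

(** The sum of the three parts is stable under ad E and ad F, hence under the
    subalgebra they generate. *)
Lemma triangular (I : finType) (a : I -> I -> int) (E F : I -> L) :
  chevalley a E F ->
  forall x, subalgebra (fun x => exists i, x = E i \/ x = F i) x ->
  exists u h w, [/\ nilpotent_part E u, coroot_span E F h, nilpotent_part F w
    & x = u + h + w].
Proof.
move=> ch; have ch' := chevalley_swap ch.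
pose Q x := exists u h w, [/\ nilpotent_part E u, coroot_span E F h,
  nilpotent_part F w & x = u + h + w].
have sE : subspace (nilpotent_part E) := subspace_ad_closure _ _.
have sF : subspace (nilpotent_part F) := subspace_ad_closure _ _.
have sH := subspace_coroot E F.
have swapH h : coroot_span F E h -> coroot_span E F h.
  move=> [c ->]; apply: subspace_sum => // i _; apply: subspaceZ => //.
  by rewrite bracketC; apply: subspaceN => //; apply: coroot_in_span.
have sQ : subspace Q.
  split=> [|b _ _ [u [h [w [nu sh nw ->]]]] [u' [h' [w' [nu' sh' nw' ->]]]]].
    by exists 0, 0, 0; rewrite !addr0; split=> //; apply: subspace0.
  exists (b *: u + u'), (b *: h + h'), (b *: w + w').
  split; [exact: subspaceP..|].
  by rewrite !scalerDr addrACA; congr (_ + _); rewrite addrACA.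
have QE u : nilpotent_part E u -> Q u.
  by exists u, 0, 0; rewrite !addr0; split=> //; apply: subspace0.
have QH h : coroot_span E F h -> Q h.
  by exists 0, h, 0; rewrite add0r addr0; split=> //; apply: subspace0.
have QF w : nilpotent_part F w -> Q w.
  by exists 0, 0, w; rewrite !add0r; split=> //; apply: subspace0.
have genE i : nilpotent_part E (E i) by apply: ad_closure_gen; exists i.
have genF i : nilpotent_part F (F i) by apply: ad_closure_gen; exists i.
have Qad i x : Q x -> Q (bracket (E i) x) /\ Q (bracket (F i) x).
  move=> [u [h [w [nu sh nw ->]]]].
  have [[c hE] [d hF]] := bracket_coroot_span ch i sh.
  rewrite !bracketDr ![bracket _ h]bracketC hE hF; split.
    apply: subspaceD => //; first (apply: subspaceD => //; apply: QE).
    - exact: ad_closure_ad.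
    - by apply: subspaceN => //; apply: subspaceZ.
    have [u' [h' [nu' sh' ->]]] := borel_lower ch' i nw.
    by apply: subspaceD => //; [apply: QF | apply/QH/swapH].
  apply: subspaceD => //; first apply: subspaceD => //.
  - have [u' [h' [nu' sh' ->]]] := borel_lower ch i nu.
    by apply: subspaceD => //; [apply: QE | apply/QH].
  - by apply: QF; apply: subspaceN => //; apply: subspaceZ.
  - by apply: QF; apply: ad_closure_ad.
have adQ := normalizer_subalgebra sQ (X := fun x => exists i, x = E i \/ x = F i).
move=> x; elim=> {x} [x [i [] ->]||b x y _ Qx _ Qy|x y Dx _ _ Qy].
- exact: QE.
- exact: QF.
- exact: (subspace0 sQ).
- exact: (subspaceP sQ).
- by apply: adQ => // _ [i [] ->] z /Qad - /(_ i)[].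
Qed.

End LieBasics.

(** * Highest weights, invariant forms and heights *)

Section WeightElement.
Variables (C : numFieldType) (L : lieAlgebra C) (I : finType).
Variables (a : I -> I -> int) (E F : I -> L) (c : I -> C).
Hypotheses (ch : chevalley a E F)
  (cP : forall j, \sum_i c i * (a i j)%:~R = 1).

(** The element rho^vee, whose adjoint action gives E i the degree 1 and F i the
    degree -1. *)
Definition height_element : L := \sum_i c i *: bracket (E i) (F i).

Lemma height_element_e j : bracket height_element (E j) = E j.
Proof.
rewrite bracket_suml -[RHS]scale1r -(cP j) scaler_suml; apply: eq_bigr => i _.
by rewrite bracketZl (chevalley_he ch) scalerA.
Qed.

Lemma height_element_f j : bracket height_element (F j) = - F j.
Proof.
rewrite bracket_suml -scaleN1r -(cP j) -sumrN scaler_suml; apply: eq_bigr => i _.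
by rewrite bracketZl (chevalley_hf ch) scalerA mulrN.
Qed.

Lemma height_element_h z : coroot_span E F z -> bracket height_element z = 0.
Proof.
move=> [d ->]; rewrite bracketC bracket_suml big1 ?oppr0 // => i _.
rewrite bracketZl bracketC bracket_suml big1 ?oppr0 ?scaler0 // => k _.
by rewrite bracketZl (chevalley_hh ch) scaler0.
Qed.

(** In the triangular decomposition the outer parts have positive and negative
    heights. *)
Lemma height0_coroot z : subalgebra (fun x => exists i, x = E i \/ x = F i) z ->
  bracket height_element z = 0 -> coroot_span E F z.
Proof.
move=> /(triangular ch)[u [h [w [nu sh nw ->]]]].
rewrite addrAC bracketDr (height_element_h sh) addr0 => uw0.
suff -> : u + w = 0 by rewrite add0r.
apply: (positive_negative_ker0 (T := ad height_element)
  (T' := ad (- height_element))) => //.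
- by move=> x; rewrite /= /ad bracketNl.
- apply: ad_closure_positive nu => [i|_ [i ->]]; first exact: height_element_e.
  exact/eigen1_positive/height_element_e.
- have HF i : bracket (- height_element) (F i) = F i.
    by rewrite bracketNl height_element_f opprK.
  apply: ad_closure_positive nw => [i|_ [i ->]]; first exact: HF.
  exact/eigen1_positive/HF.
Qed.

End WeightElement.

(** The Serre relation for orthogonal simple roots.  The bracket v of E i and
    E j is killed by all F k, so the ideal it generates is spanned by the
    iterated brackets of the E k with v, which have positive height.  It would
    not contain z, which has height 0; so v = 0 by irreducibility. *)
Lemma orthogonal_commute (C : numFieldType) (L : lieAlgebra C) (I : finType)
    (a : I -> I -> int) (E F : I -> L) (rho z : L) i j :
  chevalley a E F ->
  (forall P : L -> Prop, subspace P ->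
     (forall k x, P x -> P (bracket (E k) x) /\ P (bracket (F k) x)) ->
     (exists x, P x /\ x != 0) -> forall x, P x) ->
  (forall k, bracket rho (E k) = E k) -> bracket rho z = 0 -> z != 0 ->
  a i j = 0 -> a j i = 0 -> bracket (E i) (E j) = 0.
Proof.
move=> ch irr rhoE rhoz z0 aij aji; set v := bracket _ _.
have [//|v0] := eqVneq v 0; pose P := ad_closure E (eq v).
have sP : subspace P := subspace_ad_closure _ _.
have Pv : P v by apply: ad_closure_gen.
have HP k : P (bracket (bracket (E k) (F k)) v).
  rewrite bracket_leibniz !(chevalley_he ch) bracketZl bracketZr.
  by apply: (subspaceD sP); apply: subspaceZ.
have FP k : bracket (F k) v = 0.
  rewrite bracket_leibniz [bracket (F k) (E i)]bracketC [bracket (F k) (E j)]bracketC.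
  rewrite bracketNl bracketNr.
  have -> : bracket (bracket (E i) (F k)) (E j) = 0.
    have [<-|ik] := eqVneq i k; first by rewrite (chevalley_he ch) aij scale0r.
    by rewrite (chevalley_ef ch) // bracket0l.
  have -> : bracket (E i) (bracket (E j) (F k)) = 0.
    have [<-|jk] := eqVneq j k; last by rewrite (chevalley_ef ch) // bracket0r.
    by rewrite bracketC (chevalley_he ch) aji scale0r oppr0.
  by rewrite oppr0 addr0.
have Pz : P z.
  apply: (irr P sP) => [k x Px|]; last by exists v.
  split; first exact: ad_closure_ad.
  apply: (ad_closure_lower ch (Q := P) (X := eq v)) => //.
  - by move=> l y; apply: ad_closure_ad.
  - by move=> l _ <-; apply: HP.
  - by move=> l _ <-; rewrite FP; apply: ad_closure0.
suff /(positive_ker0 (T := ad rho) rhoz)/eqP : positive_part (ad rho) z by rewrite (negbTE z0).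
apply: ad_closure_positive Pz => // _ <-.
apply: (positive_shift (U := ad (E i))) => [y|]; last exact/eigen1_positive/rhoE.
by rewrite [LHS]bracket_leibniz rhoE addrC.
Qed.

Section HighestWeight.
Variables (C : numFieldType) (L : lieAlgebra C) (e f v : L) (lam : C).
Hypotheses (hf : bracket (bracket e f) f = - 2%:R *: f) (ev : bracket e v = 0).
Hypotheses (hv : bracket (bracket e f) v = lam *: v) (v0 : v != 0).

Local Notation h := (bracket e f).

Fixpoint lowered k := if k is k'.+1 then bracket f (lowered k') else v.

Lemma lowered_h k : bracket h (lowered k) = (lam - (k + k)%:R) *: lowered k.
Proof.
elim: k => [|k IH] /=; first by rewrite subr0.
rewrite bracket_leibniz hf IH bracketZl bracketZr -scalerDl; congr (_ *: _).
by rewrite addSn addnS -[in RHS]addn2 natrD; ring.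
Qed.

Lemma lowered_e k : bracket e (lowered k.+1) = (k.+1%:R * (lam - k%:R)) *: lowered k.
Proof.
elim: k => [|k IH]; first by rewrite /= bracket_leibniz ev bracket0r addr0 hv subr0 mul1r.
rewrite -[lowered k.+2]/(bracket f (lowered k.+1)) bracket_leibniz lowered_h IH bracketZr.
rewrite -[bracket f (lowered k)]/(lowered k.+1) -scalerDl.
by congr (_ *: _); rewrite natrD -[k.+2%:R]natr1 -[k.+1%:R]natr1; ring.
Qed.

(** The product of the h - (lam - 2m) for m < n: it kills the first n of the
    vectors f^m v and no later nonzero one. *)
Fixpoint weight_kill n x : L :=
  if n is m.+1 then
    bracket h (weight_kill m x) - (lam - (m + m)%:R) *: weight_kill m x else x.

Lemma weight_kill_linear n a x y :
  weight_kill n (a *: x + y) = a *: weight_kill n x + weight_kill n y.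
Proof.
elim: n => //= n ->; rewrite bracketDr bracketZr !scalerDr opprD addrACA scalerN.
by rewrite !scalerA mulrC.
Qed.

Lemma weight_kill_lowered n m : exists2 c,
  weight_kill n (lowered m) = c *: lowered m & (n <= m)%N -> c != 0.
Proof.
elim: n => [|n [c IH c0]]; first by exists 1; rewrite ?scale1r ?oner_neq0.
exists ((lam - (m + m)%:R) * c - (lam - (n + n)%:R) * c).
  by rewrite /= IH bracketZr lowered_h !scalerA -scalerBl [c * _]mulrC.
move=> nm; rewrite -mulrBl mulf_neq0 ?c0 //; last exact: ltnW.
by rewrite opprB addrC addrA subrK subr_eq0 eqr_nat; lia.
Qed.

(** The nonzero vectors f^k v have different weights, so there are at most as
    many as the dimension. *)
Lemma lowered_eq0 : exists k, lowered k == 0.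
Proof.
have [//|/forallNP lk0] := pselect (exists k, lowered k == 0).
have H n : exists U : {vspace L}, \dim U = n /\
    forall x, x \in U -> weight_kill n x = 0.
  elim: n => [|n [U [dimU UP]]].
    by exists 0%VS; split=> [|x]; rewrite ?dimv0 // memv0 => /eqP ->.
  exists (U + <[lowered n]>)%VS; have [c cE c0] := weight_kill_lowered n n; split.
    rewrite dimv_disjoint_sum ?dimU ?dim_vline.
      by have /negP -> := lk0 n; rewrite addn1.
    apply/eqP; rewrite -subv0; apply/subvP => x; rewrite memv_cap memv0.
    move=> /andP[/UP xU /vlineP[k xE]]; move: xU; rewrite {}xE -[_ *: _]addr0.
    rewrite weight_kill_linear cE scalerA => /eqP.
    have -> : weight_kill n 0 = 0.
      have := weight_kill_linear n (-1) v v; rewrite scaleN1r addNr => ->.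
      by rewrite scaleN1r addNr.
    by rewrite !addr0 !scaler_eq0 mulf_eq0 (negbTE (c0 (leqnn n))) orbF.
  move=> _ /memv_addP[u /UP u0 [_ /vlineP[k ->] ->]]; rewrite addrC weight_kill_linear.
  rewrite /= u0 bracket0r scaler0 subr0 addr0 cE bracketZr lowered_h !scalerA.
  by rewrite [_ * c]mulrC subrr scaler0.
have [U [dimU _]] := H (\dim {: L}).+1.
by have := dimvS (subvf U); rewrite dimU ltnn.
Qed.

(** The weights of finite dimensional sl_2-modules are integral: if f^(k+1) v is
    the first of these vectors to vanish, then 0 = e f^(k+1) v is
    (k+1)(lam - k) f^k v. *)
Lemma highest_weight_nat : exists n : nat, lam = n%:R.
Proof.
case: (ex_minnP lowered_eq0) => -[|k] /eqP lk0 kmin.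
  by move: v0; rewrite -[v]/(lowered 0) lk0 eqxx.
exists k; apply/eqP; rewrite -subr_eq0; have := lowered_e k.
rewrite lk0 bracket0r => /esym/eqP; rewrite scaler_eq0 mulf_eq0 pnatr_eq0 /=.
by case/orP => // /kmin; rewrite ltnn.
Qed.

End HighestWeight.

Section InvariantForm.
Variables (I : finType) (a : I -> I -> int) (bf : invariantForm a).
Hypothesis aii : forall i, a i i = 2.

Local Notation al := (@simple_root I).
Local Notation norm i := (bf (al i) (al i)).

Lemma form0l y : bf 0 y = 0.
Proof. by apply: (addrI (bf 0 y)); rewrite -Defs.formDl !addr0. Qed.

Lemma formNl x y : bf (- x) y = - bf x y.
Proof. by apply/eqP; rewrite -subr_eq0 opprK -Defs.formDl addNr form0l. Qed.

Lemma formMzl x n y : bf (x *~ n) y = n * bf x y.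
Proof.
have N k : bf (x *+ k) y = k%:Z * bf x y.
  elim: k => [|k IH]; first by rewrite mulr0n mul0r form0l.
  by rewrite mulrS Defs.formDl IH; lia.
by case: n => n; rewrite ?NegzE ?mulrNz ?formNl -?pmulrn N; lia.
Qed.

Lemma simple_rootMz i j n : (al i *~ n) j = (j == i)%:Z * n.
Proof.
by rewrite ffunMzE ffunE -mulrzr intz.
Qed.

Lemma simple_root_sum (x : lattice I) : x = \sum_i al i *~ x i.
Proof.
apply/ffunP => j; rewrite sum_ffunE (bigD1 j) //= big1 ?addr0 => [|i ij].
  by rewrite simple_rootMz eqxx mul1r.
by rewrite simple_rootMz eq_sym (negbTE ij) mul0r.
Qed.

(** Invariance under the reflection s_i, which maps the i-th simple root to its
    opposite. *)
Lemma form_simple i y :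
  2 * bf (al i) y = (\sum_j a i j * y j) * norm i.
Proof.
have := form_reflection bf i (al i) y; rewrite /reflection.
have -> : \sum_j a i j * al i j = 2.
  rewrite (bigD1 i) //= ffunE eqxx aii mulr1 big1 ?addr0 // => j ji.
  by rewrite ffunE (negbTE ji) mulr0.
have -> : al i *~ 2 = al i + al i by rewrite -[2]/(1 + 1) mulrzDr mulr1z.
rewrite opprD addrA subrr sub0r.
by rewrite formNl Defs.formC Defs.formDl -mulrNz formMzl ![bf y _]Defs.formC; lia.
Qed.

Lemma form_cartan i j : 2 * bf (al i) (al j) = a i j * norm i.
Proof.
rewrite form_simple (bigD1 j) //= ffunE eqxx mulr1 big1 ?addr0 // => k kj.
by rewrite ffunE (negbTE kj) mulr0.
Qed.

Lemma cartan_norm i j : a i j * norm i = a j i * norm j.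
Proof. by rewrite -!form_cartan Defs.formC. Qed.

Lemma cartan_eq0 i j : a i j = 0 -> a j i = 0.
Proof. by have := cartan_norm i j; have := form_ge2 bf j; nia. Qed.

(** Otherwise the sum of the two simple roots would have square length at most
    0. *)
Lemma cartan_bound i j : i != j -> ~ (a i j <= - 2 /\ a j i <= - 2).
Proof.
move=> ij [a1 a2]; have x0 : al i + al j != 0.
  apply/eqP => /ffunP/(_ i); rewrite !ffunE eqxx.
  by case: (i == j).
have := form_gt0 bf x0; rewrite !Defs.formDl ![bf _ (_ + _)]Defs.formC !Defs.formDl.
have := form_cartan i j; have := form_cartan j i; rewrite [bf (al j) (al i)]Defs.formC.
have := form_ge2 bf j; have := form_ge2 bf i; nia.
Qed.

(** The Cartan matrix is nonsingular: if it kills x, then <x, x> = 0. *)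
Lemma height_coefs (C : numFieldType) : exists c : I -> C,
  forall j, \sum_i c i * (a i j)%:~R = 1.
Proof.
pose A := \matrix_(k < #|I|, l < #|I|) a (enum_val k) (enum_val l).
have detA : \det A != 0.
  rewrite -det_tr; apply/det0P => -[v v0 vA].
  pose x : lattice I := [ffun i => v 0 (enum_rank i)].
  have ax i : \sum_j a i j * x j = 0.
    have /rowP/(_ (enum_rank i)) := vA; rewrite !mxE => E; rewrite -[RHS]E.
    rewrite (reindex_onto enum_val enum_rank) /=; last by move=> k _; rewrite enum_rankK.
    rewrite (eq_bigl predT) => [|k]; last by rewrite enum_valK eqxx.
    by apply: eq_bigr => k _; rewrite !mxE enum_rankK ffunE enum_valK mulrC.
  have x0 : x != 0.
    apply: contraNneq v0 => x0; apply/eqP/rowP => k.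
    by have /ffunP/(_ (enum_val k)) := x0; rewrite !ffunE enum_valK mxE.
  have := form_gt0 bf x0; rewrite {1}(simple_root_sum x).
  suff -> : bf (\sum_i al i *~ x i) x = 0 by rewrite ltxx.
  rewrite (big_morph (bf^~ x) (fun y z => Defs.formDl bf y z x) (form0l x)).
  apply: big1 => i _; rewrite formMzl; have := form_simple i x; rewrite ax; lia.
have AU : map_mx (intr : int -> C) A \in unitmx.
  by rewrite unitmxE det_map_mx unitfE intr_eq0.
pose c := const_mx 1 *m invmx (map_mx (intr : int -> C) A) : 'rV[C]_#|I|.
exists (fun i => c 0 (enum_rank i)) => j.
have /rowP/(_ (enum_rank j)) : c *m map_mx intr A = const_mx 1 by rewrite mulmxKV.
rewrite !mxE => E; rewrite -[RHS]E.
rewrite (reindex_onto enum_val enum_rank) /=; last by move=> k _; rewrite enum_rankK.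
rewrite (eq_bigl predT) => [|k]; last by rewrite enum_valK eqxx.
by apply: eq_bigr => k _; rewrite !mxE !enum_rankK enum_valK.
Qed.

End InvariantForm.

(** * Simple Lie algebras and their Dynkin diagrams *)

Section SimpleLie.
Variables (R : realType) (g : simpleLie R).

Local Notation C := (R[i] : numFieldType).
Local Notation L := (lie g : lieAlgebra C).
Local Notation e := (@chev_e R g).
Local Notation f := (@chev_f R g).
Local Notation h i := (bracket (e i) (f i)).

Definition chevalley_gen (x : g) : Prop := exists i, x = e i \/ x = f i.

Lemma simple_chevalley : @chevalley C L (Pi g) (@cartan R g) e f.
Proof.
split; [exact: chev_ef | exact: chev_hh | exact: chev_he | exact: chev_hf].
Qed.

Lemma chevalley_ind (P : g -> Prop) : subspace P ->
  (forall i, P (e i)) -> (forall i, P (f i)) ->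
  (forall x y, P x -> P y -> P (bracket x y)) -> forall x, P x.
Proof.
move=> sP Pe Pf Pb x; have [V VP] := subspace_vspace sP; apply/VP.
suff -> : V = fullv by exact: memvf.
by apply: chev_generate => [i|i|y z /VP Py /VP Pz]; apply/VP => //; apply: Pb.
Qed.

Lemma chevalley_span x : subalgebra (L := L) chevalley_gen x.
Proof.
apply: (@chevalley_ind (subalgebra (L := L) chevalley_gen)) => [|i|i|y z].
- exact: subspace_subalgebra.
- by apply: subalgebra_gen; exists i; left.
- by apply: subalgebra_gen; exists i; right.
- exact: subalgebra_bracket.
Qed.

Lemma simple_ideal (P : g -> Prop) : subspace P ->
  (forall x y, P y -> P (bracket x y)) ->
  (exists x, P x /\ x != 0) -> forall x, P x.
Proof.
move=> sP idP [x [Px x0]] y; have [V VP] := subspace_vspace sP; apply/VP.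
have [|V0|->] := (lie_simpleP g).2 V; last exact: memvf.
  by move=> u v /VP Pv; apply/VP/idP.
by move/VP: Px; rewrite V0 memv0 (negbTE x0).
Qed.

(** The elements whose adjoint action preserves P form a subalgebra. *)
Lemma chevalley_ideal (P : g -> Prop) : subspace P ->
  (forall k x, P x -> P (bracket (e k) x) /\ P (bracket (f k) x)) ->
  (exists x, P x /\ x != 0) -> forall x, P x.
Proof.
move=> sP Pad; apply: simple_ideal => // x y Py.
apply: (normalizer_subalgebra (L := L) sP _ (chevalley_span x)) Py.
by move=> _ [i [] ->] z /Pad - /(_ i)[].
Qed.

Lemma coroot_free (c : Pi g -> C) : \sum_i c i *: h i = 0 -> forall i, c i = 0.
Proof.
move=> c0 i; have := chev_h_free g.
set X := [seq _ | _ <- _]; rewrite -[X]/(tval (in_tuple X)) => /freeP fX.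
have sX : size X = #|Pi g| by rewrite size_map -cardE.
have := fX (fun k : 'I_(size X) => c (enum_val (cast_ord sX k))).
move/(_ _ (cast_ord (esym sX) (enum_rank i))); rewrite cast_ordKV enum_rankK; apply.
rewrite -[RHS]c0 [RHS](reindex_onto enum_val enum_rank) /=; last by move=> k _; rewrite enum_rankK.
rewrite [RHS](eq_bigl predT) => [|k]; last by rewrite enum_valK eqxx.
rewrite (reindex_onto (cast_ord (esym sX)) (cast_ord sX)) /=; last by move=> k _; rewrite cast_ordK.
apply: eq_big => [k|k _]; first by rewrite cast_ordKV eqxx.
rewrite cast_ordKV; congr (_ *: _).
rewrite (nth_map i) /= -?cardE ?ltn_ord //.
by rewrite -(enum_val_nth i).
Qed.

Lemma coroot_neq0 i : h i != 0.
Proof.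
apply/eqP => hi0; have := @coroot_free (fun j => (j == i)%:R).
rewrite (bigD1 i) //= eqxx scale1r hi0 add0r big1 => [|j /negbTE ->].
  by move/(_ erefl i)/eqP; rewrite eqxx oner_eq0.
by rewrite scale0r.
Qed.

Lemma chev_e_neq0 i : e i != 0.
Proof.
apply: contraNneq (coroot_neq0 i) => ->; apply/eqP; exact: (@bracket0l C L).
Qed.

Lemma chev_f_neq0 i : f i != 0.
Proof.
apply: contraNneq (coroot_neq0 i) => ->; apply/eqP; exact: (@bracket0r C L).
Qed.

(** The vector f_j has weight - a_ij for the i-th sl_2 and is killed by e_i. *)
Lemma cartan_le0 (i j : Pi g) : i != j -> cartan i j <= 0.
Proof.
move=> ij; have hf : bracket (h i) (f i) = - 2%:R *: f i :> L.
  by rewrite (chev_hf i i) cartan_diag.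
have hv : bracket (h i) (f j) = - (cartan i j)%:~R *: f j :> L by exact: chev_hf.
have [n /eqP] := highest_weight_nat (L := L) hf (chev_ef ij) hv (chev_f_neq0 j).
rewrite eqr_oppLR -[n%:R]/(n%:Z%:~R) -intrN eqr_int => /eqP ->.
by rewrite oppr_le0.
Qed.

Lemma exists_height : exists c : Pi g -> C, forall j, \sum_i c i * (cartan i j)%:~R = 1.
Proof. exact: (height_coefs (iform g) (@cartan_diag R g)). Qed.

Lemma cartan0_sym (i j : Pi g) : cartan i j = 0 -> cartan j i = 0.
Proof. exact: (cartan_eq0 (iform g) (@cartan_diag R g)). Qed.

Lemma cartan0_commute (i j : Pi g) : cartan i j = 0 ->
  bracket (e i) (e j) = 0 /\ bracket (f i) (f j) = 0.
Proof.
move=> aij; have aji := cartan0_sym aij; have [c cP] := exists_height.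
pose rho : L := height_element e f c.
have ch := simple_chevalley.
have rho_h : bracket rho (h i) = 0.
  by apply: (height_element_h c ch); apply: (coroot_in_span (L := L)).
split.
  apply: (orthogonal_commute (L := L) (rho := rho) (z := h i) ch) => //.
  - exact: chevalley_ideal.
  - exact: (height_element_e ch cP).
  - exact: coroot_neq0.
apply: (orthogonal_commute (L := L) (rho := - rho) (z := h i) (chevalley_swap ch)) => //.
- by move=> P sP Pad; apply: chevalley_ideal => // k x /Pad - /(_ k)[].
- by move=> k; rewrite bracketNl (height_element_f ch cP) opprK.
- by rewrite bracketNl rho_h oppr0.
- exact: coroot_neq0.
Qed.

(** Otherwise the subalgebra generated by the e_i and f_i, i in P, would commute
    with the other Chevalley generators and be a proper ideal. *)
Lemma cartan_connected (P : pred (Pi g)) :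
  (forall i j, P i -> ~~ P j -> cartan i j = 0) -> forall i j, P i -> P j.
Proof.
move=> Pa i0 j0 Pi0; apply/negPn/negP => Pj0.
pose S := subalgebra (L := L) (fun x => exists i, P i /\ (x = e i \/ x = f i)).
have sS : subspace S := subspace_subalgebra _.
have zero j x : ~~ P j -> S x -> bracket (e j) x = 0 /\ bracket (f j) x = 0.
  move=> Pj; elim=> {x} [x [i [Pi' xE]]||k x y _ [ex fx] _ [ey fy]|x y _ [ex fx] _ [ey fy]].
  - have ij : i != j by apply: contraNneq Pj => <-.
    have [ee ff] := cartan0_commute (cartan0_sym (Pa i j Pi' Pj)).
    case: xE => ->; rewrite ?ee ?ff; split=> //; last by apply: chev_ef; rewrite eq_sym.
    by rewrite (@bracketC C L) (chev_ef ij) oppr0.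
  - by rewrite !(@bracket0r C L).
  - by rewrite !(@bracketDr C L) !(@bracketZr C L) ex fx ey fy scaler0 addr0.
  - by rewrite !(@bracket_leibniz C L _ x) ex fx ey fy !(@bracket0l C L) !(@bracket0r C L) addr0.
have full : forall x, S x.
  apply: chevalley_ideal => // [k x Sx|].
    have [Pk|/negbTE/negbT Pk] := boolP (P k).
      by split; apply: subalgebra_bracket => //; apply: subalgebra_gen; exists k; auto.
    by have [-> ->] := zero k x Pk Sx; split; apply: subspace0.
  exists (e i0); split; last exact: chev_e_neq0.
  by apply: subalgebra_gen; exists i0; auto.
have [] := zero j0 (h j0) Pj0 (full _).
rewrite (@bracketC C L) (chev_he j0 j0) cartan_diag => /eqP.
by rewrite oppr_eq0 scaler_eq0 (negbTE (chev_e_neq0 j0)) orbF pnatr_eq0.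
Qed.

End SimpleLie.

Section DynkinIso.
Variables (R : realType) (g1 g2 : simpleLie R) (theta : Pi g1 -> Pi g2).
Hypothesis dyn : dynkin_iso theta.

Local Notation norm g i := (iform g (simple_root i) (simple_root i)).

(** Two invariant forms are proportional along edges of the diagram, hence by a
    global factor, and both have minimum 2 on the simple roots. *)
Lemma dynkin_iso_norm i : norm g2 (theta i) = norm g1 i.
Proof.
have [bth cth] := dyn.
have N1 := cartan_norm (iform g1) (@cartan_diag R g1).
have N2 := cartan_norm (iform g2) (@cartan_diag R g2).
have [i0 n0] := form_short (iform g1); have [j1 n1] := form_short (iform g2).
have [eta _ thK] := bth.
pose P (k : Pi g1) := norm g1 k * norm g2 (theta i0) == norm g1 i0 * norm g2 (theta k).
have PT k : P k.
  apply: (cartan_connected (g := g1) (P := P) _ (i := i0)); last by rewrite /P eqxx.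
  move=> k' l /eqP Pk Pl; apply/eqP; apply: contraNT Pl => akl; apply/eqP.
  have alk : cartan l k' != 0 by apply: contraNneq akl => /cartan0_sym ->.
  (* N1 and N2 give the ratio of the norms of k' and l as the same quotient of
     Cartan integers in both forms. *)
  have := N1 k' l; have := N2 (theta k') (theta l); rewrite !cth => E2 E1.
  apply: (mulfI alk); apply: (mulfI akl).
  transitivity (cartan k' l * (cartan l k' * norm g1 l) * norm g2 (theta i0)); first ring.
  rewrite -E1.
  transitivity (cartan k' l * cartan k' l * (norm g1 k' * norm g2 (theta i0))); first ring.
  rewrite Pk.
  transitivity (cartan k' l * norm g1 i0 * (cartan k' l * norm g2 (theta k'))); first ring.
  rewrite E2; ring.
have := PT (eta j1); have := PT i; rewrite /P thK n0 n1 => /eqP E1 /eqP E2.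
have := form_ge2 (iform g1) (eta j1); have := form_ge2 (iform g2) (theta i0).
move: E1 E2; move: (norm g1 _) (norm g2 _) (norm g1 _) (norm g2 _) => a m n b E1 E2 b2 a2.
have bE : b = 2 by nia.
by move: E1; rewrite bE; lia.
Qed.

End DynkinIso.

Definition lie_prod (C : fieldType) (L1 L2 : lieAlgebra C) : lieAlgebra C.
refine (@LieAlgebra C (L1 * L2)%type
  (fun x y => (bracket x.1 y.1, bracket x.2 y.2)) _ _ _ _).
- move=> y k u v; congr (_, _); exact: bracket_linearl.
- move=> y k u v; congr (_, _); exact: bracket_linearr.
- by move=> x; rewrite !bracket_alt.
- by move=> x y z; congr (_, _); apply: bracket_jacobi.
Defined.

Section LieIso.
Variables (R : realType) (g1 g2 : simpleLie R) (theta : Pi g1 -> Pi g2).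
Hypothesis dyn : dynkin_iso theta.

Local Notation C := (R[i] : numFieldType).
Local Notation L := (lie_prod g1 g2 : lieAlgebra C).

Definition diag_e (i : Pi g1) : L := (chev_e i, chev_e (theta i)).
Definition diag_f (i : Pi g1) : L := (chev_f i, chev_f (theta i)).
Definition diagonal : L -> Prop :=
  subalgebra (fun x => exists i, x = diag_e i \/ x = diag_f i).

Lemma diag_chevalley : chevalley (L := L) (@cartan R g1) diag_e diag_f.
Proof.
have [bth cth] := dyn; split=> [i j ij|i j|i j|i j].
- by congr (_, _); apply: chev_ef; rewrite // (inj_eq (bij_inj bth)).
- by congr (_, _); apply: chev_hh.
- by congr (_, _); rewrite /= chev_he ?cth.
- by congr (_, _); rewrite /= chev_hf ?cth.
Qed.

Lemma diagonal_bracket x1 x2 y1 y2 :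
  diagonal (x1, x2) -> diagonal (y1, y2) -> diagonal (bracket x1 y1, bracket x2 y2).
Proof. exact: subalgebra_bracket. Qed.

Lemma diagonal_lin k x1 x2 y1 y2 : diagonal (x1, x2) -> diagonal (y1, y2) ->
  diagonal (k *: x1 + y1, k *: x2 + y2).
Proof. exact: subalgebraP. Qed.

Lemma diagonal_total x : exists y, diagonal (x, y).
Proof.
apply: (@chevalley_ind R g1 (fun x => exists y, diagonal (x, y))) => [|i|i|].
- split=> [|k u v [u' Du] [v' Dv]]; first by exists 0; apply: subalgebra0.
  by exists (k *: u' + v'); apply: diagonal_lin.
- by exists (chev_e (theta i)); apply: subalgebra_gen; exists i; left.
- by exists (chev_f (theta i)); apply: subalgebra_gen; exists i; right.
by move=> u v [u' Du] [v' Dv]; exists (bracket u' v'); apply: diagonal_bracket.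
Qed.

Lemma diagonal_surj y : exists x, diagonal (x, y).
Proof.
have [[eta _ thK] _] := dyn.
apply: (@chevalley_ind R g2 (fun y => exists x, diagonal (x, y))) => [|i|i|].
- split=> [|k u v [u' Du] [v' Dv]]; first by exists 0; apply: subalgebra0.
  by exists (k *: u' + v'); apply: diagonal_lin.
- by exists (chev_e (eta i)); apply: subalgebra_gen; exists (eta i); left; rewrite /diag_e thK.
- by exists (chev_f (eta i)); apply: subalgebra_gen; exists (eta i); right; rewrite /diag_f thK.
by move=> u v [u' Du] [v' Dv]; exists (bracket u' v'); apply: diagonal_bracket.
Qed.

Lemma sum_pair (I : finType) (c : I -> C) (u : I -> L) :
  \sum_i c i *: u i = (\sum_i c i *: (u i).1, \sum_i c i *: (u i).2).
Proof. by elim/big_rec3: _ => // i y1 y2 y3 _ ->; case: (u i). Qed.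

(** The part of height 0 of the diagonal subalgebra has only the dimension of one
    Cartan subalgebra, not of two. *)
Lemma diagonal_coroot z1 z2 : diagonal (z1, z2) ->
  (forall i, bracket (bracket (chev_e i) (chev_f i)) z1 = 0) ->
  (forall i : Pi g2, bracket (bracket (chev_e i) (chev_f i)) z2 = 0) ->
  exists c : Pi g1 -> C,
    z1 = \sum_i c i *: bracket (chev_e i) (chev_f i) /\
    z2 = \sum_i c i *: bracket (chev_e (theta i)) (chev_f (theta i)).
Proof.
move=> Dz hz1 hz2; have [c cP] := exists_height g1.
have [|d] := height0_coroot diag_chevalley cP Dz.
  rewrite /height_element (@bracket_suml C L) big1 // => i _.
  rewrite (@bracketZl C L) -[RHS](scaler0 _ (c i)); congr (_ *: _).
  by congr (_, _); [apply: hz1 | apply: hz2].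
by rewrite sum_pair => -[-> ->]; exists d.
Qed.

(** These y form an ideal of g2.  If it were everything, the diagonal would
    contain (0, h_j), contrary to [diagonal_coroot]. *)
Lemma diagonal_fun y : diagonal (0, y) -> y = 0.
Proof.
move=> Dy; apply/eqP/negPn/negP => y0.
have full : forall z, diagonal (0, z).
  apply: (@simple_ideal R g2 (fun z => diagonal (0, z))); last by exists y.
    split=> [|k u v Du Dv]; first exact: subalgebra0.
    by have := diagonal_lin k Du Dv; rewrite scaler0 addr0.
  move=> u v Dv; have [u' Du] := diagonal_surj u.
  by have := diagonal_bracket Du Dv; rewrite (@bracket0r C g1).
have [j _] := form_short (iform g2).
have [i||c [/esym/coroot_free c0 /eqP]] := diagonal_coroot (full (bracket (chev_e j) (chev_f j))).
- exact: (@bracket0r C g1).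
- by move=> i; apply: chev_hh.
rewrite big1 ?(negbTE (coroot_neq0 j)) // => i _.
by rewrite c0 scale0r.
Qed.

Lemma diagonal_inj x : diagonal (x, 0) -> x = 0.
Proof.
move=> Dx; apply/eqP/negPn/negP => x0.
have full : forall z, diagonal (z, 0).
  apply: (@simple_ideal R g1 (fun z => diagonal (z, 0))); last by exists x.
    split=> [|k u v Du Dv]; first exact: subalgebra0.
    by have := diagonal_lin k Du Dv; rewrite scaler0 addr0.
  move=> u v Dv; have [u' Du] := diagonal_total u.
  by have := diagonal_bracket Du Dv; rewrite (@bracket0r C g2).
have [j _] := form_short (iform g1); have [[eta thetaK etaK] _] := dyn.
have [i||c [cE c0]] := diagonal_coroot (full (bracket (chev_e j) (chev_f j))).
- exact: chev_hh.
- by move=> i; apply: (@bracket0r C g2).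
have {}c0 i : c i = 0.
  have /coroot_free/(_ (theta i)) : \sum_k c (eta k) *: bracket (chev_e k) (chev_f k) = 0 :> g2.
    rewrite [RHS]c0 (reindex_onto theta eta) /= => [|k _]; last exact: etaK.
    by apply: eq_big => [k|k _]; rewrite thetaK ?eqxx.
  by rewrite thetaK.
move: (coroot_neq0 j); rewrite cE big1 ?eqxx // => i _.
by rewrite c0 scale0r.
Qed.

Lemma dynkin_iso_lie : lie_isomorphic g1 g2.
Proof.
pose phi x := sval (cid (diagonal_total x)).
have phiP x : diagonal (x, phi x) by exact: (svalP (cid (diagonal_total x))).
have phiE x y : diagonal (x, y) -> phi x = y.
  move=> Dy; have := diagonal_lin (-1) Dy (phiP x).
  rewrite !scaleN1r addNr => /diagonal_fun/eqP.
  by rewrite addrC subr_eq0 => /eqP.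
have lin_phi : linear phi by move=> k u v; apply/phiE/diagonal_lin.
pose lin := GRing.isLinear.Build R[i] g1 g2 *:%R phi lin_phi.
pose Phi : {linear g1 -> g2} := HB.pack phi lin.
exists Phi; split=> [|x y]; last exact/phiE/diagonal_bracket.
exists (fun y => sval (cid (diagonal_surj y))) => [x|y]; last first.
  exact/phiE/(svalP (cid (diagonal_surj y))).
have Dx := svalP (cid (diagonal_surj (Phi x))).
have := diagonal_lin (-1) Dx (phiP x); rewrite !scaleN1r addNr => /diagonal_inj/eqP.
by rewrite addrC subr_eq0 => /eqP.
Qed.

End LieIso.

(** * Sets of roots of the twisted algebras and the classification *)

Section CocycleR.
Variables (Q : zmodType) (K : fieldType) (p : cocycle Q K).

Lemma cocycle_r_neq0 x y : cocycle_r p x y != 0.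
Proof. by rewrite mulf_neq0 ?invr_neq0 // cocycle_neq0. Qed.

Lemma cocycle_rV x y : cocycle_r p y x = (cocycle_r p x y)^-1.
Proof. by rewrite /cocycle_r invf_div. Qed.

Lemma cocycle_rxx x : cocycle_r p x x = 1.
Proof. by rewrite /cocycle_r mulfV // cocycle_neq0. Qed.

Lemma cocycle_rDl x y z :
  cocycle_r p (x + y) z = cocycle_r p x z * cocycle_r p y z.
Proof.
have := cocycleP p x y z; have := cocycleP p z x y; have := cocycleP p x z y.
rewrite /cocycle_r [z + x]addrC [z + y]addrC.
move: (cocycle_neq0 p x y) (cocycle_neq0 p z x) (cocycle_neq0 p z y)
  (cocycle_neq0 p z (x + y)) (cocycle_neq0 p (x + z) y).
move: (p x y) (p (x + y) z) (p y z) (p x (y + z)) (p z x) (p (x + z) y)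
  (p z (x + y)) (p x z) (p z y) => a b c d e f g u v a0 e0 v0 g0 f0 E3 E2 E1.
apply: (mulfI (mulf_neq0 a0 f0)).
transitivity (f * (a * b) / g); first by field.
rewrite E1; transitivity (c * (f * d) / g); first by field.
have gE : g = e * f / a by rewrite E2; field.
have dE : d = u * f / v by rewrite E3; field.
by rewrite gE dE; field; rewrite a0 e0 v0 f0.
Qed.

Lemma cocycle_r0l x : cocycle_r p 0 x = 1.
Proof. by rewrite /cocycle_r cocycle0l cocycle0r mulfV // cocycle_neq0. Qed.

Lemma cocycle_rNl x y : cocycle_r p (- x) y = (cocycle_r p x y)^-1.
Proof.
apply: (mulfI (cocycle_r_neq0 x y)).
by rewrite -cocycle_rDl addrN cocycle_r0l mulfV // cocycle_r_neq0.
Qed.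

Lemma cocycle_rNN x y : cocycle_r p (- x) (- y) = cocycle_r p x y.
Proof.
by rewrite cocycle_rNl (cocycle_rV (- y)) invrK cocycle_rNl (cocycle_rV x y) invrK.
Qed.

End CocycleR.

Section SerreDegree.
Variables (R : realType) (g : simpleLie R) (K : fieldType) (q : K).

Lemma serre_degE (i j : Pi g) : i != j -> cartan i j = 1 - (serre_deg i j)%:Z.
Proof. by move=> /cartan_le0; rewrite /serre_deg; lia. Qed.

Lemma serre_deg_gt0 (i j : Pi g) : i != j -> (0 < serre_deg i j)%N.
Proof. by move=> /cartan_le0; rewrite /serre_deg; lia. Qed.

Lemma qroot_expn (i : Pi g) : exists2 d, (0 < d)%N & qroot q i = q ^+ d.
Proof.
have := form_ge2 (iform g) i; have /divzK := form_even (iform g) (simple_root i).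
rewrite /qroot; case: (_ %/ 2)%Z => d E le2; last by move: le2; rewrite -E; lia.
by exists d => //; move: le2; rewrite -E; lia.
Qed.

End SerreDegree.

Section SerreRoots.
Variables (R : realType) (g : simpleLie R) (K : fieldType) (q : K).
Hypotheses (q_neq0 : q != 0) (qN1 : forall n : nat, (0 < n)%N -> q ^+ n != 1).
Variables (s : bool) (p : cocycle (lattice (Pi g)) K).

Local Notation al := (@simple_root (Pi g)).
Local Notation r i j := (cocycle_r p (al i) (al j)).

(** As r is bimultiplicative, the gradings of the two signs give the same r. *)
Lemma cocycle_r_wt i j : cocycle_r p (wt s i) (wt s j) = r i j.
Proof. by rewrite /wt; case: s => //; apply: cocycle_rNN. Qed.

Lemma qroot_neq0 (i : Pi g) : qroot q i != 0.
Proof. by have [d _ ->] := qroot_expn q i; rewrite expf_neq0. Qed.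

Lemma qroot_not_root_of_unity (i : Pi g) n : (0 < n)%N -> qroot q i ^+ n != 1.
Proof.
by have [d d0 ->] := qroot_expn q i => n0; rewrite -exprM qN1 // muln_gt0 d0.
Qed.

Lemma twist_rootsE i j :
  twist_roots q s p i j = qroots (qroot q i) (r i j) (serre_deg i j).
Proof. by rewrite /twist_roots cocycle_r_wt. Qed.

Lemma twist_roots_commuting (i j : Pi g) :
  cartan i j = 0 -> twist_roots q s p i j = [:: r i j].
Proof. by move=> aij; rewrite twist_rootsE /serre_deg aij /= mulr1. Qed.

Hypothesis generic : forall i j : Pi g, cartan i j = -1 ->
  qroot q i * r i j != 1 /\ (qroot q i)^-1 * r i j != 1.

Lemma generic_roots (i j : Pi g) : cartan i j = -1 ->
  1 \notin twist_roots q s p i j.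
Proof.
move=> aij; rewrite twist_rootsE /serre_deg aij /= !inE.
have [n1 n2] := generic aij; rewrite expr1 expr0 mulr1 negb_or ![1 == _]eq_sym.
by rewrite [r i j * _]mulrC n1 /= [r i j / _]mulrC n2.
Qed.

(** For the last property: if i and j are adjacent, positivity of the form forces
    one of the Cartan integers to be -1, and then genericity excludes the root
    1. *)
Lemma twist_serre_roots : serre_roots (twist_roots q s p).
Proof.
split=> i j.
- move=> _; rewrite twist_rootsE; apply: qroots_uniq.
  + exact: qroot_neq0.
  + exact: qroot_not_root_of_unity.
  + exact: cocycle_r_neq0.
- by move=> /eqP ij; rewrite twist_rootsE size_qroots serre_deg_gt0.
- move=> _; rewrite twist_rootsE; apply: qroots_neq0; first exact: qroot_neq0.
  exact: cocycle_r_neq0.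
- move=> z /eqP ij Sz; have := congr1 size Sz; rewrite twist_rootsE size_qroots /= => d1.
  have aij : cartan i j = 0 by rewrite (serre_degE ij) d1.
  rewrite (twist_roots_commuting (cartan0_sym aij)) cocycle_rV.
  by move: Sz; rewrite (twist_roots_commuting aij) => -[->].
move=> /eqP ij Sij Sji; have [aij|aij] := eqVneq (cartan i j) 0.
  by move: Sij; rewrite (twist_roots_commuting aij) inE => /eqP <-.
have aji : cartan j i != 0 by apply: contraNneq aij => /cartan0_sym ->.
have ji : j != i by rewrite eq_sym.
have := cartan_bound (iform g) (@cartan_diag R g) ij.
have [a1|n1] := eqVneq (cartan i j) (-1).
  by move: (generic_roots a1); rewrite Sij.
have [a2|n2] := eqVneq (cartan j i) (-1).
  by move: (generic_roots a2); rewrite Sji.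
case; move: (cartan_le0 ij) (cartan_le0 ji) aij aji n1 n2; lia.
Qed.

End SerreRoots.

Lemma dynkin_iso_qroot (R : realType) (g1 g2 : simpleLie R)
    (theta : Pi g1 -> Pi g2) (K : fieldType) (q : K) i :
  dynkin_iso theta -> qroot q (theta i) = qroot q i.
Proof. by move=> dyn; rewrite /qroot (dynkin_iso_norm dyn). Qed.

Lemma dynkin_iso_serre_deg (R : realType) (g1 g2 : simpleLie R)
    (theta : Pi g1 -> Pi g2) i j :
  dynkin_iso theta -> serre_deg (theta i) (theta j) = serre_deg i j.
Proof. by move=> [_ cth]; rewrite /serre_deg cth. Qed.

Theorem theorem6p9 (R : realType) (g1 g2 : simpleLie R)
  (K : fieldType) (q : K)
  (q_neq0 : q != 0)
  (q_not_root_of_unity : forall n : nat, (0 < n)%N -> q ^+ n != 1)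
  (p1 : cocycle (lattice (Pi g1)) K) (p2 : cocycle (lattice (Pi g2)) K)
  (generic1 : forall i j : Pi g1, cartan i j = -1 ->
     qroot q i * cocycle_r p1 (simple_root i) (simple_root j) != 1 /\
     (qroot q i)^-1 * cocycle_r p1 (simple_root i) (simple_root j) != 1)
  (generic2 : forall i j : Pi g2, cartan i j = -1 ->
     qroot q i * cocycle_r p2 (simple_root i) (simple_root j) != 1 /\
     (qroot q i)^-1 * cocycle_r p2 (simple_root i) (simple_root j) != 1)
  (torsionfree : torsion_free (group_prod (Gp q p1) (Gp q p2)))
  (s : bool) :
  alg_isomorphic (Uqp q s p1) (Uqp q s p2) <->
  lie_isomorphic g1 g2 /\
  exists theta : Pi g1 -> Pi g2, dynkin_iso theta /\
    forall i j : Pi g1,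
      cocycle_r p2 (simple_root (theta i)) (simple_root (theta j))
        = cocycle_r p1 (simple_root i) (simple_root j).
Proof.
have t1 := @qroot_neq0 R g1 K q q_neq0; have t2 := @qroot_neq0 R g2 K q q_neq0.
have u1 := @qroot_not_root_of_unity R g1 K q q_not_root_of_unity.
have u2 := @qroot_not_root_of_unity R g2 K q q_not_root_of_unity.
have pres1 := twist_presented (q := q) s p1 u1 t1.
have pres2 := twist_presented (q := q) s p2 u2 t2.
split=> [iso|[_ [theta [dyn rE]]]]; last first.
  apply: (serre_presented_iso pres1 pres2 dyn.1) => i j _.
  by rewrite !twist_rootsE (dynkin_iso_qroot q i dyn) dynkin_iso_serre_deg // rE.
have roots1 := twist_serre_roots q_neq0 q_not_root_of_unity s generic1.
have roots2 := twist_serre_roots q_neq0 q_not_root_of_unity s generic2.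
have [theta bth thS] := alg_iso_roots roots1 roots2 pres1 pres2 iso.
have inj := bij_inj bth.
have thP i j : i <> j ->
    perm_eq (twist_roots q s p2 (theta i) (theta j)) (twist_roots q s p1 i j).
  move=> ij; apply: uniq_perm; [|exact: (roots_uniq roots1)|exact: thS].
  by apply: (roots_uniq roots2) => /inj.
have dyn : dynkin_iso theta.
  split=> // i j; have [->|ij] := eqVneq i j; first by rewrite !cartan_diag.
  have /eqP ij' := ij; have tij : theta i != theta j by rewrite (inj_eq inj).
  have := perm_size (thP i j ij'); rewrite !twist_rootsE !size_qroots => E.
  by rewrite (serre_degE tij) (serre_degE ij) E.
split; first exact: dynkin_iso_lie dyn.
exists theta; split=> // i j; have [->|ij] := eqVneq i j; first by rewrite !cocycle_rxx.
have : \sum_(z <- twist_roots q s p2 (theta i) (theta j)) z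
    = \sum_(z <- twist_roots q s p1 i j) z by apply/perm_big/thP/eqP.
rewrite !twist_rootsE (dynkin_iso_qroot q i dyn) dynkin_iso_serre_deg //.
rewrite !(sum_qroots (t1 i) (u1 i)) => /mulIf; apply.
by apply: (qint_neq0 (t1 i) (u1 i)); apply: serre_deg_gt0.
Qed.
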